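(* There exists $p_0$ such that the following holds for every prime $p>p_0$. Suppose that $A\subseteq \mathbb{Z}/p\mathbb{Z}$ is sum-free and that $n:=|A|>0.318\,p$. Then there exists an integer $d$ such that $A\subseteq d\ast[n,p-n]_p$.
   Context: A subset $A$ of an additively written abelian group is sum-free if there are no $a_1,a_2,a_3\in A$ (not necessarily distinct) with $a_1+a_2=a_3$. Let $\phi_p:\mathbb{Z}\to\mathbb{Z}/p\mathbb{Z}$ be the canonical homomorphism; for a set $\mathcal S\subseteq\mathbb{Z}$, $\mathcal S_p$ denotes $\phi_p(\mathcal S)$, and an interval such as $[n,p-n]$ denotes the set of integers in it, so $[n,p-n]_p=\phi_p(\{z\in\mathbb{Z}: n\le z\le p-n\})$. For an integer $d$ and a subset $S$ of an abelian group, $d\ast S:=\{ds: s\in S\}$. *)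

(* Defs.v *)
From mathcomp Require Export all_boot all_order all_algebra.
From mathcomp Require Export classical_sets.

Set Implicit Arguments.
Unset Strict Implicit.
Unset Printing Implicit Defensive.

Import GRing.Theory Num.Theory.

Local Open Scope ring_scope.
Local Open Scope classical_set_scope.

Definition sum_free (G : zmodType) (A : set G) : Prop :=
  forall a1 a2 a3 : G, A a1 -> A a2 -> A a3 -> a1 + a2 <> a3.

(* The set S_p: the image of S under the canonical map from the integers to   *)
(* Z/pZ. The type 'F_p is Z/pZ only for prime p.                              *)
Definition residues (p : nat) (S : set int) : set 'F_p :=
  [set (z%:~R : 'F_p) | z in S].
Arguments residues p S : clear implicits.

Definition dilate (G : zmodType) (d : int) (S : set G) : set G :=
  [set s *~ d | s in S].

(* Main.v *)
From Stdlib Require Import Reals Lra.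
Require Import Defs.
From mathcomp Require Import classical_sets.
From mathcomp Require Import all_boot all_order all_algebra all_fingroup.
From mathcomp Require Import cyclic Rstruct.
From mathcomp Require Import zify lra ring.

(** Let [n = |A|].
    - Since A is sum-free, the Fourier transform satisfies
      [sum_z |A^(z)|^2 Re A^(z) = 0], hence [Re A^(z) <= - n^2 / (p - n)] for some
      nonzero frequency z.  Truncating the cosine at a level slightly below 1
      turns this into a half-circle that contains at least [0.2352 p] elements
      of a dilate of A.
    - These elements, read as integers, form a set with [|2 A0| <= p - n < 3 |A0| - 3],
      so by Freiman's theorem (deduced from Kneser's theorem modulo the length of
      the hull) they lie, after another dilation, in an interval of length
      [l <= p - n - m], where m is their number.
    - The differences of this part of A fill most of [[-l, l]], so A contains most of
      the window [M = (l, p - l)].  An element z of A with [|z| < m] would force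
      [m / 2 <= |z| <= l + 1 - m] and would exclude A from most of the windows
      [M + z] and [M - z]; counting A piece by piece then gives
      [5 n + 6 m <= 3 p + 5], a contradiction.  So A avoids [(-m, m)], and A
      being disjoint from its shift by its element nearest to 0 finishes
      the proof. *)

Set Implicit Arguments.
Unset Strict Implicit.
Unset Printing Implicit Defensive.
Import GRing.Theory Num.Theory Order.TTheory.

(** * Counting in intervals of integers *)

(** Sets are boolean predicates on [nat]: a subset of Z/pZ becomes a p-periodic predicate, and an
    arc becomes an interval of integers. *)
Definition cnt (f : pred nat) (a l : nat) : nat := (\sum_(i < l) f (a + i))%N.

Section Counting.
Local Open Scope nat_scope.
Implicit Types (f g : pred nat) (a b l : nat).

Lemma cnt0 f a : cnt f a 0 = 0.
Proof. by rewrite /cnt big_ord0. Qed.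

Lemma cntS f a l : cnt f a l.+1 = cnt f a l + f (a + l).
Proof. by rewrite /cnt big_ord_recr. Qed.

Lemma cnt1 f a : cnt f a 1 = f a.
Proof. by rewrite cntS cnt0 addn0. Qed.

Lemma cnt_cat f a l1 l2 : cnt f a (l1 + l2) = cnt f a l1 + cnt f (a + l1) l2.
Proof.
elim: l2 => [|l2 IH]; first by rewrite cnt0 !addn0.
by rewrite addnS !cntS IH !addnA.
Qed.

Lemma cnt_split f a b c l1 l2 :
  b = a + l1 -> c = l1 + l2 -> cnt f a c = cnt f a l1 + cnt f b l2.
Proof. by move=> -> ->; rewrite cnt_cat. Qed.

Lemma cnt_size f a l : cnt f a l <= l.
Proof. by elim: l => [|l IH]; rewrite ?cnt0 // cntS; lia. Qed.

Lemma cnt_leq f g a b l :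
  (forall i, i < l -> f (a + i) -> g (b + i)) -> cnt f a l <= cnt g b l.
Proof.
elim: l => [|l IH] H; first by rewrite !cnt0.
rewrite !cntS leq_add ?IH // => [i il|]; first by apply: H; lia.
by have := H l (ltnSn l); case: (f _) => // ->.
Qed.

Lemma eq_cnt f g a b l :
  (forall i, i < l -> f (a + i) = g (b + i)) -> cnt f a l = cnt g b l.
Proof.
move=> H; apply/eqP; rewrite eqn_leq; apply/andP.
by split; apply: cnt_leq => i il; rewrite H.
Qed.

Lemma cnt_eq0 f a l : (forall i, i < l -> ~~ f (a + i)) -> cnt f a l = 0.
Proof.
move=> H; apply/eqP; rewrite -leqn0 -(cnt0 f a).
elim: l H => [|l IH] H; first by rewrite cnt0.
by rewrite cntS (negbTE (H _ (ltnSn l))) addn0 IH // => i il; apply: H; lia.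
Qed.

Lemma cnt_pair f g a b l :
  (forall i, i < l -> ~~ (f (a + i) && g (b + i))) -> cnt f a l + cnt g b l <= l.
Proof.
elim: l => [|l IH] H; first by rewrite !cnt0.
have := IH (fun i il => H i (ltnW il)); have := H l (ltnSn l).
by rewrite !cntS; case: (f _); case: (g _) => //=; lia.
Qed.

Lemma cnt_rev f g a b l :
  (forall i j, i + j.+1 = l -> f (a + i) = g (b + j)) -> cnt f a l = cnt g b l.
Proof.
move=> H; rewrite /cnt (reindex_inj rev_ord_inj) /=; apply: eq_bigr => i _.
by rewrite (H _ i) //; have := ltn_ord i; lia.
Qed.

Lemma cnt_period p f a b :
  (forall x, f (x + p) = f x) -> cnt f a p = cnt f b p.
Proof.
move=> fP; have S x : cnt f x.+1 p = cnt f x p.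
  have := cnt_cat f x 1 p; have := cnt_cat f x p 1.
  by rewrite !cnt1 fP addnC addn1 => -> ; lia.
have Z x : cnt f x p = cnt f 0 p by elim: x => // x <-.
by rewrite !Z.
Qed.

Definition zfree f z := forall x, ~~ (f x && f (x + z)).

(** The two halves of the block are translates of each other by z. *)
Lemma zfree_block f z a : zfree f z -> cnt f a (z + z) <= z.
Proof.
move=> zf; rewrite cnt_cat; apply: cnt_pair => i _.
by rewrite addnAC; apply: zf.
Qed.

Lemma zfree_le f z a l : zfree f z -> l <= z + z -> cnt f a l <= z.
Proof.
move=> zf lz; have := zfree_block a zf.
by rewrite (@cnt_split _ a (a + l) (z + z) l (z + z - l)) //; lia.
Qed.

Lemma zfree_ge f z a l : zfree f z -> z + z <= l -> cnt f a l + z <= l.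
Proof.
move=> zf lz; have := zfree_block a zf.
have := cnt_size f (a + (z + z)) (l - (z + z)).
by rewrite (@cnt_split f a (a + (z + z)) l (z + z) (l - (z + z))) //; lia.
Qed.

Lemma zfree_ge2 f z a l :
  zfree f z -> z + z + (z + z) <= l -> cnt f a l + (z + z) <= l.
Proof.
move=> zf lz; have := zfree_block a zf.
have := @zfree_ge f z (a + (z + z)) (l - (z + z)) zf.
by rewrite (@cnt_split f a (a + (z + z)) l (z + z) (l - (z + z))) //; lia.
Qed.

End Counting.

(** * Sum-free sets that are dense in a short interval *)

Section SumFreeInterval.
Local Open Scope nat_scope.
Variables (p : nat) (f : pred nat).
Hypothesis fP : forall x, f (x + p) = f x.
Hypothesis fS : forall x y, f x -> f y -> ~~ f (x + y).

Let n := cnt f 0 p.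
(** [p - z] stands for -z, so for z <= p this is the union of A and -A. *)
Let E z := f z || f (p - z).

(** If -z is in A, then x + z in A forbids the sum x, so both signs of z forbid the difference z. *)
Lemma sym_zfree z : z <= p -> E z -> zfree f z.
Proof.
move=> zp /orP[fz|fz] x; apply/negP => /andP[fx fxz].
  by move: (fS fx fz); rewrite fxz.
have := fS fxz fz; rewrite (_ : x + z + (p - z) = x + p); last by lia.
by rewrite fP fx.
Qed.

Lemma sym_diffN x d : d <= p -> f x -> f (x + d) -> E d = false.
Proof.
move=> dp fx fxd; apply/negP => /(sym_zfree dp) /(_ x).
by rewrite fx fxd.
Qed.

Lemma sum_free0 : f 0 = false.
Proof. by apply/negP => h; move: (fS h h); rewrite addn0 h. Qed.

(** * Consequences of one interval that is more than half full *)

Section Dense.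
Variables (u l : nat).
Let m := cnt f u l.+1.
Hypothesis fu : f u.
Hypothesis ful : f (u + l).
Hypothesis lm : l + 3 <= 2 * m.
Hypothesis lp : 2 * l < p.
(** For m near 0.2352 p and n near 0.318 p, [big1] is the tight inequality: 5 n + 6 m is then 3.0012
    p. *)
Hypothesis big1 : 3 * p + 5 < 5 * n + 6 * m.
Hypothesis big2 : p + 1 < 3 * m + n.
Hypothesis big3 : 4 * p + 4 <= 9 * m + 6 * n.

(** The window consists of the integers strictly between l and p - l; [mu] is its length and [k] its
    share of A. The d counted by [e] are holes: they are not differences of elements of A. *)
Let mu := p - 2 * l - 1.
Let k := cnt f l.+1 mu.
Let e := cnt E 1 l.

Let El : E l = false.
Proof. by apply: (@sym_diffN u) => //; lia. Qed.

Let l0 : 0 < l.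
Proof. by case: (posnP l) lm => // l0; rewrite /m l0 cnt1 fu. Qed.

(** If u + d is in A, then d and l - d are differences of elements of A, because both ends of the
    interval are in A. If d and l - d were both holes, [u, u + l) would be at most half full,
    against [lm]. *)
Lemma holes_pair d : 0 < d < l -> E d + E (l - d) + f (u + d) <= 1.
Proof.
move=> dl; have [fd|_] := boolP (f (u + d)).
  rewrite (@sym_diffN u d) //; last by lia.
  rewrite (@sym_diffN (u + d) (l - d)) //; first by lia.
  by rewrite (_ : u + d + (l - d) = u + l) //; lia.
rewrite addn0; case: (boolP (E d)) => // Ed; case: (boolP (E (l - d))) => // Eld.
have zd : zfree f d by apply: sym_zfree => //; lia.
have zl : zfree f (l - d) by apply: sym_zfree => //; lia.
have h1 : cnt f u (l - d) + cnt f (u + d) (l - d) <= l - d.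
  by apply: cnt_pair => i _; rewrite addnAC; apply: zd.
have h2 : cnt f u d + cnt f (u + (l - d)) d <= d.
  by apply: cnt_pair => i _; rewrite addnAC; apply: zl.
have e1 : cnt f u l = cnt f u (l - d) + cnt f (u + (l - d)) d.
  by apply: cnt_split => //; lia.
have e2 : cnt f u l = cnt f u d + cnt f (u + d) (l - d).
  by apply: cnt_split => //; lia.
have : m = cnt f u l + 1 by rewrite /m cntS ful.
lia.
Qed.

(** Sum [holes_pair] over 0 < d < l: each hole is counted twice, through d and l - d, and the
    interior of the interval has m - 2 points of A. *)
Lemma holes_le : 2 * e + m <= l.+1.
Proof.
have lE : l = l.-1.+1 by rewrite prednK.
have E1 : e = cnt E 1 l.-1 by rewrite /e lE cntS -lE add1n -lE El addn0.
have E2 : e = cnt (fun d => E (l - d)) 1 l.-1.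
  by rewrite E1; apply: cnt_rev => i j ij; congr E; lia.
have M : m = cnt f u.+1 l.-1 + 2.
  have : cnt f u l = cnt f u 1 + cnt f u.+1 l.-1 by apply: cnt_split; lia.
  by rewrite cnt1 fu /m cntS ful; lia.
suff : cnt E 1 l.-1 + cnt (fun d => E (l - d)) 1 l.-1 + cnt f u.+1 l.-1 <= l.-1.
  by rewrite -E1 -E2 M; lia.
rewrite /cnt -!big_split /=; apply: leq_trans (_ : \sum_(i < l.-1) 1 <= _).
  apply: leq_sum => i _; rewrite add1n addSnnS; apply: holes_pair.
  by have := ltn_ord i; lia.
by rewrite sum_nat_const card_ord muln1.
Qed.

Lemma cnt_low_le : cnt f 1 l <= e.
Proof. by apply: cnt_leq => i _ h; rewrite /E h. Qed.

Lemma cnt_high_le : cnt f (p - l) l <= e.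
Proof.
rewrite (@cnt_rev f (fun d => f (p - d)) (p - l) 1 l); last first.
  by move=> i j ij; congr f; lia.
by apply: cnt_leq => i _ h; rewrite /E h orbT.
Qed.

(** Outside the window, A has at most e points on each side of 0, and 2 e <= l + 1 - m. *)
Lemma middle_ge : n + m <= k + l.+1.
Proof.
have := holes_le; have := cnt_low_le; have := cnt_high_le.
have -> : n = cnt f 0 1 + cnt f 1 (p - 1) by apply: cnt_split => //; lia.
have -> : cnt f 1 (p - 1) = cnt f 1 l + cnt f l.+1 (p - 1 - l).
  by apply: cnt_split => //; lia.
have -> : cnt f l.+1 (p - 1 - l) = k + cnt f (p - l) l.
  by apply: cnt_split; lia.
by rewrite cnt1 sum_free0; lia.
Qed.

Lemma middle_le : k <= mu.
Proof. exact: cnt_size. Qed.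

(** The window without its last z places and its translate by z together hold at most mu - z points;
    the z places left over at each end add at most z each. *)
Lemma sym_ge z : z <= p -> E z -> 2 * k <= mu + z.
Proof.
move=> zp /(sym_zfree zp) zf; have := middle_le.
case: (leqP mu z) => [|zmu] kmu; first by lia.
have h : cnt f l.+1 (mu - z) + cnt f (l.+1 + z) (mu - z) <= mu - z.
  by apply: cnt_pair => i _; rewrite addnAC; apply: zf.
have e1 : k = cnt f l.+1 z + cnt f (l.+1 + z) (mu - z).
  by apply: cnt_split => //; lia.
have e2 : k = cnt f l.+1 (mu - z) + cnt f (l.+1 + (mu - z)) z.
  by apply: cnt_split => //; lia.
have := cnt_size f l.+1 z; have := cnt_size f (l.+1 + (mu - z)) z.
lia.
Qed.

(** From z < m follows 2 z <= l, so [zfree_ge] gives the second bound. If 4 z <= l + 1, then m + 2 z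
    <= l + 1; together with 2 n + 2 m <= p + 1 + z and l <= p - n - m this gives 5 n + 6 m <= 3 p +
    3, against [big1]. *)
Lemma sym_small z : z < m -> E z -> m <= 2 * z /\ z + m <= l.+1.
Proof.
move=> zm Ez; have ml : m <= l.+1 by apply: cnt_size.
have zp : z <= p by lia.
have zf := sym_zfree zp Ez; have := sym_ge zp Ez; have := middle_ge; have := middle_le.
have h1 : l.+1 <= z + z -> m <= z by apply: zfree_le.
have h2 : z + z <= l.+1 -> m + z <= l.+1 by apply: zfree_ge.
have h3 : z + z + (z + z) <= l.+1 -> m + (z + z) <= l.+1 by apply: zfree_ge2.
have h4 : l.+1 <= z + z + (z + z) -> m <= z + z.
  move=> le; apply: leq_trans (_ : cnt f u (z + z + (z + z)) <= _).
    rewrite (@cnt_split f u (u + l.+1) _ l.+1 (z + z + (z + z) - l.+1)) //; first by rewrite leq_addr.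
    by lia.
  by rewrite cnt_cat leq_add // zfree_block.
lia.
Qed.

(** With z1 and z2 the extreme counterexamples, the circle is cut at z1, z2, m, l + 1 - z2, l + 1 -
    z1 and, up to off-by-ones, their mirror images, and A is bounded on each piece. *)
Lemma sym_none z : z < m -> E z = false.
Proof.
move=> zm; apply/negP => Ez.
have ml : m <= l.+1 by apply: cnt_size.
pose Q := fun y => (y < m) && E y.
have exQ : exists y, Q y by exists z; rewrite /Q zm.
have [z1 /andP[z1m Ez1] min1] := ex_minnP exQ.
have bQ y : Q y -> y <= m by case/andP; lia.
have [z2 /andP[z2m Ez2] max2] := ex_maxnP exQ bQ.
have z12 : z1 <= z2 by apply: min1; rewrite /Q z2m.
have [m1 l1] := sym_small z1m Ez1; have [m2 l2] := sym_small z2m Ez2.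
have zf1 : zfree f z1 by apply: sym_zfree => //; lia.
have zf2 : zfree f z2 by apply: sym_zfree => //; lia.
have mid := middle_ge; have kmu := middle_le.
(* If mu > 2 z1, then [zfree_ge] leads to n + 3 m <= p + 1, against [big2]. *)
have kz1 : k <= z1.
  case: (leqP mu (z1 + z1)) => h; first exact: zfree_le.
  by have : k + z1 <= mu; [apply: zfree_ge => //; lia | lia].
have out y : (y < z1) || (z2 < y < m) -> E y = false.
  move=> hy; apply/negP => Ey; have Qy : Q y by rewrite /Q Ey andbT; lia.
  by have := min1 _ Qy; have := max2 _ Qy; lia.
have outf y : (y < z1) || (z2 < y < m) -> ~~ f y.
  by move=> /out /negbT; rewrite /E negb_or => /andP[].
have outp y : y <= p -> (p - y < z1) || (z2 < p - y < m) -> ~~ f y.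
  by move=> yp /out /negbT; rewrite /E negb_or (subKn yp) => /andP[].
(* This is [big3], given z2 <= l + 1 - m, m <= 2 z1 and l <= p - n - m. *)
have dmu : z2 - z1 <= mu by lia.
(* The last z2 - z1 places of the window, shifted by z2, land here. *)
have right : cnt f (p - l + z1) (z2 - z1) + k <= mu.
  have h : cnt f (p - l - (z2 - z1)) (z2 - z1) + cnt f (p - l + z1) (z2 - z1) <= z2 - z1.
    apply: cnt_pair => i il.
    by rewrite (_ : p - l + z1 + i = p - l - (z2 - z1) + i + z2) //; lia.
  have -> : k = cnt f l.+1 (mu - (z2 - z1)) + cnt f (p - l - (z2 - z1)) (z2 - z1).
    by apply: cnt_split; lia.
  by have := cnt_size f l.+1 (mu - (z2 - z1)); lia.
have left : cnt f (l.+1 - z2) (z2 - z1) + k <= mu.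
  have h : cnt f (l.+1 - z2) (z2 - z1) + cnt f l.+1 (z2 - z1) <= z2 - z1.
    apply: cnt_pair => i il.
    by rewrite (_ : l.+1 + i = l.+1 - z2 + i + z2) //; lia.
  have -> : k = cnt f l.+1 (z2 - z1) + cnt f (l.+1 + (z2 - z1)) (mu - (z2 - z1)).
    by apply: cnt_split; lia.
  by have := cnt_size f (l.+1 + (z2 - z1)) (mu - (z2 - z1)); lia.
(* The block of length 2 z1 around l + 1 holds at most z1 points; the rest is the window shifted by
   z1. *)
have mid1 : cnt f (l.+1 - z1) (mu + 2 * z1) + k <= mu + z1.
  have -> : cnt f (l.+1 - z1) (mu + 2 * z1)
          = cnt f (l.+1 - z1) (z1 + z1) + cnt f (l.+1 + z1) mu.
    by apply: cnt_split; lia.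
  have := zfree_block (l.+1 - z1) zf1.
  have : k + cnt f (l.+1 + z1) mu <= mu.
    by apply: cnt_pair => i _; rewrite addnAC; apply: zf1.
  lia.
have n1 : n = cnt f 0 z1 + cnt f z1 (p - z1) by apply: cnt_split => //; lia.
have n2 : cnt f z1 (p - z1) = cnt f z1 (z2 - z1).+1 + cnt f z2.+1 (p - z2.+1).
  by apply: cnt_split; lia.
have n3 : cnt f z2.+1 (p - z2.+1) = cnt f z2.+1 (m - z2.+1) + cnt f m (p - m).
  by apply: cnt_split; lia.
have n4 : cnt f m (p - m) = cnt f m (l.+1 - z2 - m) + cnt f (l.+1 - z2) (p - (l.+1 - z2)).
  by apply: cnt_split; lia.
have n5 : cnt f (l.+1 - z2) (p - (l.+1 - z2)) =
   cnt f (l.+1 - z2) (z2 - z1) + cnt f (l.+1 - z1) (p - (l.+1 - z1)).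
  by apply: cnt_split; lia.
have n6 : cnt f (l.+1 - z1) (p - (l.+1 - z1)) =
   cnt f (l.+1 - z1) (mu + 2 * z1) + cnt f (p - l + z1) (l - z1).
  by apply: cnt_split; lia.
have n7 : cnt f (p - l + z1) (l - z1) =
   cnt f (p - l + z1) (z2 - z1) + cnt f (p - l + z2) (l - z2).
  by apply: cnt_split; lia.
have n8 : cnt f (p - l + z2) (l - z2) =
   cnt f (p - l + z2) (l.+1 - m - z2) + cnt f (p - m).+1 m.-1.
  by apply: cnt_split; lia.
have n9 : cnt f (p - m).+1 m.-1 =
   cnt f (p - m).+1 (m.-1 - z2) + cnt f (p - z2) z2.
  by apply: cnt_split; lia.
have n10 : cnt f (p - z2) z2 =
   cnt f (p - z2) (z2 - z1).+1 + cnt f (p - z1).+1 z1.-1.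
  by apply: cnt_split; lia.
have s1 : cnt f 0 z1 = 0 by apply: cnt_eq0 => i il; apply: outf; lia.
have s2 : cnt f z2.+1 (m - z2.+1) = 0 by apply: cnt_eq0 => i il; apply: outf; lia.
have s3 : cnt f (p - m).+1 (m.-1 - z2) = 0 by apply: cnt_eq0 => i il; apply: outp; lia.
have s4 : cnt f (p - z1).+1 z1.-1 = 0 by apply: cnt_eq0 => i il; apply: outp; lia.
have t1 := cnt_size f z1 (z2 - z1).+1.
have t2 := cnt_size f m (l.+1 - z2 - m).
have t3 := cnt_size f (p - l + z2) (l.+1 - m - z2).
have t4 := cnt_size f (p - z2) (z2 - z1).+1.
(* The pieces give n + 3 k + z1 <= 2 (l + 2 - m) + 3 mu; then k <= z1 and [middle_ge] yield 5 n + 6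
   m <= 3 p + 5. *)
lia.
Qed.

(** Let z be the distance from 0 to A. Then A lies in [z, p - z] and misses its shift by z, so n <=
    z unless n + 3 z <= p + 1, which z >= m and [big2] exclude. *)
Lemma sum_free_interval x : x < p -> f x -> n <= x /\ x <= p - n.
Proof.
move=> xp fx.
pose Q := fun y => (y < p) && E y.
have x0 : 0 < x by case: (posnP x) fx => // ->; rewrite sum_free0.
have exQ : exists y, Q y by exists x; rewrite /Q /E xp fx.
have [z /andP[zp Ez] minz] := ex_minnP exQ.
have mz : m <= z by rewrite leqNgt; apply/negP => /sym_none; rewrite Ez.
have zf := sym_zfree (ltnW zp) Ez.
have lo y : y < z -> ~~ f y.
  move=> yz; apply/negP => fy.
  have Qy : Q y by rewrite /Q /E fy andbT; lia.
  by have := minz _ Qy; lia.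
have hi y : p - z < y < p -> ~~ f y.
  move=> yz; apply/negP => fy.
  have Qy : Q (p - y) by rewrite /Q /E subKn ?fy ?orbT ?andbT; lia.
  by have := minz _ Qy; lia.
have zx : z <= x by rewrite leqNgt; apply/negP => /lo; rewrite fx.
have xz : x <= p - z by rewrite leqNgt; apply/negP => h; have := hi x; rewrite h xp fx => /(_ isT).
have nE : n = cnt f z (p - z - z).+1.
  have -> : n = cnt f 0 z + cnt f z (p - z) by apply: cnt_split; lia.
  have -> : cnt f z (p - z) = cnt f z (p - z - z).+1 + cnt f (p - z).+1 z.-1.
    by apply: cnt_split; lia.
  rewrite (@cnt_eq0 f 0); last by move=> i il; apply: lo; lia.
  by rewrite (@cnt_eq0 f (p - z).+1) ?addn0 // => i il; apply: hi; lia.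
suff : n <= z by lia.
case: (leqP (p - z - z).+1 (z + z)) => h; first by rewrite nE; apply: zfree_le.
by have := @zfree_ge f z z (p - z - z).+1 zf (ltnW h); lia.
Qed.

End Dense.
End SumFreeInterval.

(** * Kneser's theorem *)

Ltac lia_card := repeat match goal with |- context [#|?A|] => move: #|A| end; clear; lia.

Section Kneser.
Local Open Scope group_scope.
Variable gT : finGroupType.
Hypothesis mulC : forall x y : gT, x * y = y * x.
Implicit Types (A B C : {set gT}) (x y : gT).

Definition stabset C : {set gT} := [set g | C :* g == C].

Lemma group_set_stabset C : group_set (stabset C).
Proof.
apply/group_setP; split=> [|x y]; rewrite !inE ?rcoset1 //.
by move=> /eqP hx /eqP hy; rewrite rcosetM hx hy.
Qed.
Definition stab C : {group gT} := Group (group_set_stabset C).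

Lemma stabE C g x : g \in stab C -> (x * g \in C) = (x \in C).
Proof. by rewrite inE => /eqP h; rewrite -{1}h mem_rcoset mulgK. Qed.

Lemma stabI C g : (forall x, x \in C -> x * g \in C) -> g \in stab C.
Proof.
move=> h; rewrite inE eqEcard card_rcoset leqnn andbT.
by apply/subsetP => x /rcosetP[y yC ->]; apply: h.
Qed.

(** Let H1 and H2 be the stabilizers. The difference of C1 and C2 contains x H1 minus C2 and the
    part of x H2 in C1; these overlap only inside x times the intersection of H1 and H2, which
    stabilizes the union. *)
Lemma card_union_step C1 C2 x : x \in C1 -> x \notin C2 ->
  #|C1 :|: C2| + #|stab (C1 :|: C2)| < #|C2| + #|stab C2| ->
  #|(x *: stab C1) :\: C2| < #|(x *: stab C2) :\: C1|.
Proof.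
move=> x1 x2 lt.
have C12 : #|C1 :|: C2| = (#|C2| + #|C1 :\: C2|)%N.
  by rewrite -(cardsID C2) setUC setUK setDUl setDv set0U.
have sub : ((x *: stab C1) :\: C2) :|: ((x *: stab C2) :&: C1) \subset C1 :\: C2.
  apply/subsetP => y; rewrite !inE => /orP[/andP[-> /lcosetP[g g1 ->]]|].
    by rewrite stabE.
  by case/andP=> /lcosetP[g g2 ->] ->; rewrite stabE // x2.
have subI : ((x *: stab C1) :\: C2) :&: ((x *: stab C2) :&: C1)
            \subset x *: (stab C1 :&: stab C2).
  apply/subsetP => y; rewrite !(in_setI, in_setD) => /andP[/andP[_ y1] /andP[y2 _]].
  by move: y1 y2; rewrite !mem_lcoset in_setI => -> ->.
have subS : stab C1 :&: stab C2 \subset stab (C1 :|: C2).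
  apply/subsetP => g; rewrite in_setI => /andP[g1 g2]; apply: stabI => y.
  by rewrite !in_setU !stabE.
have := subset_leq_card sub; have := subset_leq_card subI.
have := subset_leq_card subS; rewrite card_lcoset.
have := cardsUI ((x *: stab C1) :\: C2) ((x *: stab C2) :&: C1).
have := cardsID C1 (x *: stab C2); rewrite card_lcoset.
by move: lt; rewrite C12; lia_card.
Qed.

(** If x H1 misses C2, the previous lemma compares |H1| and |H2|. Otherwise some x g h, with g in H1
    and h in H2, lies in C2 but not in C1, and the step applied there with C1 and C2 exchanged
    reverses the strict inequality. *)
Lemma card_union_case C1 C2 x : x \in C1 -> x \notin C2 ->
  #|C1 :|: C2| + #|stab (C1 :|: C2)| < #|C1| + #|stab C1| ->
  #|C1 :|: C2| + #|stab (C1 :|: C2)| < #|C2| + #|stab C2| ->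
  #|stab C1| < #|stab C2|.
Proof.
move=> x1 x2 lt1 lt2; have lt := card_union_step x1 x2 lt2.
have [D0|[w]] := set_0Vmem ((x *: stab C1) :&: C2).
  have := cardsID C2 (x *: stab C1); rewrite D0 cards0 card_lcoset add0n => <-.
  apply: leq_trans lt _; rewrite -(card_lcoset (stab C2) x).
  exact/subset_leq_card/subsetDl.
rewrite inE => /andP[/lcosetP[g g1 ->] w2].
have : 0 < #|(x *: stab C2) :\: C1| by apply: leq_ltn_trans lt.
case/card_gt0P => v; rewrite inE => /andP[v1 /lcosetP[h h2 vE]].
rewrite {}vE in v1.
have y2 : x * g * h \in C2 by rewrite stabE.
have y1 : x * g * h \notin C1 by rewrite -mulgA (mulC g) mulgA stabE.
have := @card_union_step C2 C1 (x * g * h); rewrite setUC => /(_ y2 y1 lt1).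
have shift C C' u t : u \in stab C' -> t \in stab C ->
    #|(x * u * t *: stab C) :\: C'| = #|(x *: stab C) :\: C'|.
  move=> uC' tC; rewrite -(card_rcoset ((x *: stab C) :\: C') u); apply: eq_card => z.
  rewrite mem_rcoset !in_setD !mem_lcoset -(@stabE C' u (z * u^-1)) // mulgKV.
  congr (_ && _); rewrite (_ : (x * u * t)^-1 * z = x^-1 * (z * u^-1) * t^-1); last first.
    rewrite !invMg -mulgA mulC; congr (_ * _).
    by rewrite -mulgA mulC -mulgA.
  by rewrite groupMr // groupV.
rewrite shift // -(mulgA x) (mulC g) mulgA shift // => lt'.
by move: (ltn_trans lt lt'); rewrite ltnn.
Qed.

(** A failure would allow [card_union_case] in both directions, giving |H1| < |H2| < |H1|. *)
Lemma card_stab_setU C1 C2 N :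
  N <= #|C1| + #|stab C1| -> N <= #|C2| + #|stab C2| ->
  N <= #|C1 :|: C2| + #|stab (C1 :|: C2)|.
Proof.
move=> N1 N2; rewrite leqNgt; apply/negP => lt.
have [s12|/subsetPn[x x1 x2]] := boolP (C1 \subset C2).
  by move: lt; rewrite (setUidPr s12) ltnNge N2.
have [s21|/subsetPn[y y2 y1]] := boolP (C2 \subset C1).
  by move: lt; rewrite (setUidPl s21) ltnNge N1.
have := card_union_case x1 x2 (leq_trans lt N1) (leq_trans lt N2).
have := @card_union_case C2 C1 y y2 y1; rewrite setUC.
by move=> /(_ (leq_trans lt N2) (leq_trans lt N1)); lia.
Qed.

Lemma mulsC A B : A * B = B * A.
Proof.
by apply/setP => z; apply/mulsgP/mulsgP => -[x y xA yB ->];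
   exists y x => //; rewrite mulC.
Qed.

(* Dyson's e-transform of (A, B) moves B into A until B lies in a coset of the stabilizer of A. *)
Lemma kneser_local A B a b : a \in A -> b \in B ->
  exists2 C : {set gT}, (C \subset A * B) && (a * b \in C) & #|A| + #|B| <= #|C| + #|stab C|.
Proof.
have [k] := ubnP #|B|; elim: k A B => // k IH A B ltk aA bB.
have [/exists_inP[a' a'A /subsetPn[y /rcosetP[b1 b1B ->] b1e]]|] :=
  boolP [exists a' in A, ~~ (B :* (b^-1 * a') \subset A)].
  set e := b^-1 * a' in b1e.
  pose A' := A :|: B :* e; pose B' := B :&: A :* e^-1.
  have aA' : a \in A' by rewrite inE aA.
  have bB' : b \in B' by rewrite inE bB mem_rcoset invgK mulKVg.
  have ltB : #|B'| < #|B|.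
    apply: proper_card; rewrite properE subsetIl; apply/subsetPn.
    by exists b1; rewrite // !inE b1B mem_rcoset invgK.
  have [|C /andP[sC abC] cC] := IH A' B' _ aA' bB'; first by apply: leq_trans ltB _.
  exists C; last first.
    have le : #|A :&: B :* e| <= #|B'|.
      rewrite -(card_rcoset B' e); apply/subset_leq_card/subsetP => z.
      rewrite inE => /andP[zA /rcosetP[b2 b2B zE]]; rewrite {}zE in zA *.
      by rewrite mem_rcoset mulgK inE b2B mem_rcoset invgK.
    by move: (cardsUI A (B :* e)) le cC; rewrite card_rcoset -/A'; lia_card.
  rewrite abC andbT; apply: subset_trans sC _.
  apply/subsetP => _ /mulsgP[u v uA' vB' ->]; move: vB'; rewrite inE mem_rcoset invgK.
  move: uA'; rewrite inE => /orP[uA|/rcosetP[b2 b2B ->]] /andP[vB veA].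
    by apply/mulsgP; exists u v.
  by rewrite mulsC; apply/mulsgP; exists b2 (v * e); rewrite // -mulgA (mulC e).
rewrite negb_exists_in => /forall_inP h.
(* Now B b^-1 a' lies in A for every a' in A, so B b^-1 stabilizes A b. *)
exists (A :* b).
  apply/andP; split; last by rewrite mem_rcoset mulgK.
  by apply: mulgS; rewrite sub1set.
rewrite card_rcoset leq_add2l -(card_rcoset B b^-1); apply: subset_leq_card.
apply/subsetP => g /rcosetP[y yB ->]; apply: stabI => x /rcosetP[c cA ->].
have /negbNE/subsetP/(_ (y * (b^-1 * c))) := h c cA.
rewrite mem_rcoset mulgK => /(_ yB) yA.
rewrite mem_rcoset (_ : c * b * (y * b^-1) * b^-1 = y * (b^-1 * c)) //.
by rewrite -(mulgA c) (mulC b) mulgKV (mulC c) -mulgA (mulC c).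
Qed.

(** The subsets C of A B with |A| + |B| <= |C| + |stab C| are closed under union, and [kneser_local]
    gives one through each point of A B; so a largest one is A B. *)
Lemma kneser A B : A != set0 -> B != set0 ->
  #|A| + #|B| <= #|A * B| + #|stab (A * B)|.
Proof.
move=> /set0Pn[a aA] /set0Pn[b bB].
pose good (C : {set gT}) := (C \subset A * B) && (#|A| + #|B| <= #|C| + #|stab C|).
have [C0 /andP[sC0 _] cC0] := kneser_local aA bB.
have gC0 : good C0 by rewrite /good sC0.
have [C /andP[sC cC] maxC] := @arg_maxnP _ C0 good (fun C => #|C|) gC0.
suff -> : A * B = C by [].
apply/eqP; rewrite eqEsubset sC andbT; apply/subsetP => _ /mulsgP[x y xA yB ->].
apply/negPn/negP => xyC.
have [C1 /andP[sC1 xyC1] cC1] := kneser_local xA yB.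
have : good (C :|: C1) by rewrite /good subUset sC sC1 card_stab_setU.
move=> /maxC; apply/negP; rewrite -ltnNge; apply: proper_card.
by rewrite properE subsetUl; apply/subsetPn; exists (x * y); rewrite // inE xyC1 orbT.
Qed.

(** [kneser] is applied to A H, whose square is again A A. *)
Lemma kneser_double A : A != set0 ->
  exists H : {group gT}, A * A * H = A * A /\ (2 * #|(A * H)%g| <= #|(A * A)%g| + #|H|)%N.
Proof.
move=> A0; exists (stab (A * A)); set H := stab _.
have AH : A * A * H = A * A.
  apply/eqP; rewrite eqEsubset mulG_subl andbT; apply/subsetP => _ /mulsgP[x y xA yH ->].
  by rewrite stabE.
split=> //.
have H0 : A * H != set0.
  by case/set0Pn: A0 => a aA; apply/set0Pn; exists a; apply: (subsetP (mulG_subl _ _)).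
have E : (A * H) * (A * H) = A * A.
  by rewrite mulgA -(mulgA A) (mulsC H) mulgA -mulgA mulGid AH.
by have := kneser H0 H0; rewrite E -/H; lia_card.
Qed.

End Kneser.

(** * Freiman's 3k-3 theorem *)

Section Freiman.
Local Open Scope nat_scope.

(** This is |X + Y| >= |X| + |Y| - 1: the sets X + min Y and max X + Y meet only in max X + min
    Y. *)
Lemma sumset_cnt (fX fY G : pred nat) l x0 y0 :
  x0 < l -> fX x0 -> y0 < l -> fY y0 ->
  (forall x y, x < l -> y < l -> fX x -> fY y -> G (x + y)) ->
  cnt fX 0 l + cnt fY 0 l <= (cnt G 0 (2 * l)).+1.
Proof.
move=> x0l fx0 y0l fy0 H.
have exX : exists x, (x < l) && fX x by exists x0; rewrite x0l.
have bX x : (x < l) && fX x -> x <= l by case/andP; lia.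
have exY : exists y, (y < l) && fY y by exists y0; rewrite y0l.
have [x1 /andP[x1l fx1] max1] := ex_maxnP exX bX.
have [y1 /andP[y1l fy1] min1] := ex_minnP exY.
have -> : cnt fX 0 l = cnt fX 0 x1.+1 + cnt fX x1.+1 (l - x1.+1).
  by apply: cnt_split; lia.
rewrite (@cnt_eq0 fX x1.+1) ?addn0; last first.
  move=> i il; apply/negP => h; have := max1 (x1.+1 + i).
  by rewrite h andbT; lia.
have -> : cnt fY 0 l = cnt fY 0 y1 + cnt fY y1 (l - y1) by apply: cnt_split; lia.
rewrite (@cnt_eq0 fY 0) ?add0n; last first.
  move=> i il; apply/negP => h; have := min1 (0 + i).
  by rewrite h andbT; lia.
have -> : cnt fY y1 (l - y1) = cnt fY y1 1 + cnt fY y1.+1 (l - y1.+1).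
  by apply: cnt_split; lia.
rewrite cnt1 fy1.
have h1 : cnt fX 0 x1.+1 <= cnt G y1 x1.+1.
  by apply: cnt_leq => i il fi; rewrite addnC; apply: H => //; lia.
have h2 : cnt fY y1.+1 (l - y1.+1) <= cnt G (y1 + x1.+1) (l - y1.+1).
  apply: cnt_leq => i il fi; rewrite (_ : y1 + x1.+1 + i = x1 + (y1.+1 + i)); last by lia.
  by apply: H => //; lia.
have -> : cnt G 0 (2 * l) = cnt G 0 y1 + cnt G y1 (2 * l - y1) by apply: cnt_split; lia.
have -> : cnt G y1 (2 * l - y1) = cnt G y1 x1.+1 + cnt G (y1 + x1.+1) (2 * l - y1 - x1.+1).
  by apply: cnt_split; lia.
have -> : cnt G (y1 + x1.+1) (2 * l - y1 - x1.+1) = cnt G (y1 + x1.+1) (l - y1.+1)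
   + cnt G (y1 + x1.+1 + (l - y1.+1)) (l - x1).
  by apply: cnt_split; lia.
lia.
Qed.

Lemma cnt_card l (f : pred nat) : cnt f 0 l = #|[set i : 'I_l | f i]|.
Proof.
rewrite /cnt -sum1_card big_mkcond [RHS]big_mkcond /=; apply: eq_bigr => i _.
by rewrite inE add0n; case: (f i).
Qed.

Lemma cnt_double l (g : pred nat) :
  cnt g 0 (2 * l) = \sum_(r < l) (g r + g (r + l)).
Proof.
rewrite mul2n -addnn cnt_cat /cnt -big_split /=; apply: eq_bigr => i _.
by rewrite !add0n addnC [l + i]addnC addnC.
Qed.

(** Modulo l the points 0 and l merge, so B has k - 1 elements. Two sums, b and b + l, lie over each
    residue b of B, and at least one over any other residue of B + B. Unless B + B is everything,
    Kneser's theorem supplies a period H, and [sumset_cnt] counts the sums over a coset of H outside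
    B + H. The group ['I_l] is written multiplicatively. *)
Lemma freiman_3k3 l (f g : pred nat) : 0 < l -> f 0 -> f l ->
  (forall d, (forall x, x <= l -> f x -> d %| x) -> d = 1) ->
  (forall x y, x <= l -> y <= l -> f x -> f y -> g (x + y)) ->
  let k := cnt f 0 l.+1 in let s := cnt g 0 (2 * l).+1 in
  (l + k <= s) \/ (3 * k <= s + 3).
Proof.
case: l => // l' _; set l := l'.+1 => f0 fl gcd1 fg k s.
pose B : {set 'I_l} := [set i : 'I_l | f i].
pose w (r : nat) := g r + g (r + l).
have kE : k = #|B|.+1 by rewrite /k cntS add0n fl cnt_card addn1.
have sE : s = (\sum_(r < l) w r).+1.
  rewrite /s cntS cnt_double add0n.
  by have := fg _ _ (leqnn l) (leqnn l) fl fl; rewrite addnn -mul2n => ->; rewrite addn1.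
have B1 : (1 : 'I_l)%g \in B by rewrite inE.
have valM (a b : 'I_l) : val (a * b)%g = (a + b) %% l by [].
have mulC (a b : 'I_l) : (a * b = b * a)%g by apply: val_inj; rewrite !valM addnC.
set S := (B * B)%g.
have wS (r : 'I_l) : r \in S -> 1 <= w r.
  case/mulsgP => a b; rewrite !inE => fa fb ->; rewrite valM.
  have al := ltn_ord a; have bl := ltn_ord b.
  have gab : g (a + b) by apply: fg => //; lia.
  case: (ltnP (a + b) l) => h; first by rewrite modn_small // /w gab; lia.
  have -> : (a + b) %% l = a + b - l.
    by rewrite -{1}(subnK h) modnDr modn_small //; lia.
  by rewrite /w subnK // gab; lia.
have wB (r : 'I_l) : r \in B -> w r = 2.
  rewrite inE => fr; have rl := ltn_ord r; rewrite /w.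
  have -> : g (r + l) by apply: fg => //; lia.
  have -> // : g r; by rewrite -[X in g X]addn0; apply: fg => //; lia.
have B0 : B != set0 by apply/set0Pn; exists 1%g.
have [H []] := kneser_double mulC B0; rewrite -/S => SH cH.
have BS : (B * H \subset S)%g.
  rewrite -SH; apply: mulSg; apply/subsetP => x xB.
  by apply/mulsgP; exists 1%g x; rewrite ?mul1g.
have [ST|SnT] := eqVneq S setT.
  left; rewrite kE sE.
  have : \sum_(r < l) (1 + (r \in B)) <= \sum_(r < l) w r.
    apply: leq_sum => r _; case: (boolP (r \in B)) => [/wB ->//|_].
    by apply: wS; rewrite ST inE.
  rewrite big_split /= sum_nat_const card_ord muln1.
  rewrite (_ : \sum_(r < l) (r \in B) = #|B|); last first.
    by rewrite -sum1_card [RHS]big_mkcond; apply: eq_bigr => r _; case: (r \in B).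
  by rewrite addnS ltnS.
right.
(* Otherwise Kneser's bound forces B H = H, so B lies in the subgroup H, and gcd 1 makes H
   everything. *)
have [c cS cBH] : exists2 c, c \in S & c \notin (B * H)%g.
  apply/subsetPn; apply: contra SnT => sub.
  have BHH : (B * H = H)%g.
    apply/eqP; rewrite eq_sym eqEcard; apply/andP; split.
      by apply/subsetP => h hH; apply/mulsgP; exists 1%g h; rewrite ?mul1g.
    by move: cH (subset_leq_card sub); lia_card.
  have BH : B \subset H by rewrite -BHH mulG_subl.
  have HT : H :=: setT.
    have dl : #|H| %| l by have := cardSg (subsetT H); rewrite cardsT card_ord.
    have d1 : l %/ #|H| = 1.
      apply: gcd1 => x xl fx.
      have [->|xn] := eqVneq x l; first exact: dvdn_div.
      have xlt : x < l by rewrite ltn_neqAle xn.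
      have xB : Ordinal xlt \in H by apply: (subsetP BH); rewrite inE.
      have := expg_cardG xB; rewrite Zp_expg => /(congr1 val) /= h.
      by rewrite -(dvdn_pmul2r (cardG_gt0 H)) divnK // /dvdn h.
    apply/eqP; rewrite eqEcard subsetT cardsT card_ord.
    by rewrite -[X in X <= _](divnK dl) d1 mul1n /=.
  rewrite -SH HT; apply/eqP/setP => x; rewrite inE; apply/mulsgP.
  by exists 1%g x; rewrite ?mul1g ?inE // /S; apply/mulsgP; exists 1%g 1%g; rewrite ?mul1g.
case/mulsgP: (cS) => b1 b2 b1B b2B cE.
pose X := B :&: (b1 *: H)%g; pose Y := B :&: (b2 *: H)%g.
have BHB : B \subset (B * H)%g by apply: mulG_subl.
(* The coset b H has no more points outside B than B H has. *)
have cX b : b \in B -> #|H| + #|B| <= #|B :&: (b *: H)%g| + #|(B * H)%g|.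
  move=> bB; rewrite -(card_lcoset H b) -(cardsID B (b *: H)%g) setIC.
  rewrite -(cardsID B (B * H)%g) (setIidPr BHB).
  have : #|(b *: H)%g :\: B| <= #|(B * H)%g :\: B|.
    by apply/subset_leq_card/setSD/mulSg; rewrite sub1set.
  by lia_card.
have cXY : #|X| + #|Y| <= (\sum_(r < l | r \in (c *: H)%g) w r).+1.
  pose fX x := f x && (inZp x \in (b1 *: H)%g).
  pose fY x := f x && (inZp x \in (b2 *: H)%g).
  pose G x := g x && (inZp x \in (c *: H)%g).
  have EX (F : {set 'I_l}) : #|B :&: F| = cnt (fun x => f x && (inZp x \in F)) 0 l.
    rewrite cnt_card; apply: eq_card => i.
    rewrite in_setI !in_set (_ : inZp i = i) //.
    by apply: val_inj; rewrite /= modn_small.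
  rewrite EX EX.
  have -> : \sum_(r < l | r \in (c *: H)%g) w r = cnt G 0 (2 * l).
    rewrite cnt_double big_mkcond; apply: eq_bigr => r _; rewrite /G.
    have -> : (inZp (r + l) : 'I_l) = r by apply: val_inj; rewrite /= modnDr modn_small.
    have -> : (inZp r : 'I_l) = r by apply: val_inj; rewrite /= modn_small.
    by case: (r \in _); rewrite ?andbT ?andbF.
  have inb b : b \in B -> (f b) && (inZp b \in (b *: H)%g).
    rewrite inE => ->; rewrite (_ : inZp b = b) ?lcoset_refl //.
    by apply: val_inj; rewrite /= modn_small.
  apply: (@sumset_cnt _ _ _ _ b1 b2); rewrite ?ltn_ord ?inb //.
  move=> x y xl yl /andP[fx xH] /andP[fy yH]; rewrite /G fg ?(ltnW xl) ?(ltnW yl) //=.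
  rewrite (_ : inZp (x + y) = (inZp x * inZp y : 'I_l)%g); last first.
    by apply: val_inj; rewrite /= modnDm.
  case/lcosetP: xH => h1 h1H ->; case/lcosetP: yH => h2 h2H ->.
  rewrite cE mem_lcoset (_ : b1 * h1 * (b2 * h2) = b1 * b2 * (h1 * h2))%g.
    by rewrite mulKg groupM.
  by rewrite -!mulgA; congr (_ * _)%g; rewrite !mulgA (mulC h1).
have cHS : (c *: H \subset S)%g by rewrite -SH; apply: mulSg; rewrite sub1set.
have dis : [disjoint (c *: H)%g & (B * H)%g].
  rewrite -setI_eq0; apply/eqP/setP => x; rewrite !inE; apply/negP.
  case/andP=> /lcosetP[h hH ->] /mulsgP[b h' bB h'H e]; case/negP: cBH.
  apply/mulsgP; exists b (h' * h^-1)%g; rewrite ?groupM ?groupV //.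
  by rewrite mulgA -e mulgK.
pose T := (S :\: (B * H)%g) :\: (c *: H)%g.
have cT : #|T| + #|H| + #|(B * H)%g| = #|S|.
  rewrite -(cardsID (B * H)%g S) (setIidPr BS) addnC; congr (_ + _).
  rewrite -(cardsID (c *: H)%g (S :\: (B * H)%g)) addnC; congr (_ + _).
  rewrite (setIidPr _) ?card_lcoset //.
  by rewrite subsetD cHS.
have : \sum_(r < l | r \in (c *: H)%g) w r + (#|(B * H)%g| + #|B|) + #|T| <= \sum_(r < l) w r.
  rewrite [X in _ <= X](bigID (fun r => r \in (c *: H)%g)) /= -addnA leq_add2l.
  rewrite [X in _ <= X](bigID (fun r => r \in (B * H)%g)) /=; apply: leq_add.
    apply: leq_trans (_ : \sum_(r < l | r \in (B * H)%g) (1 + (r \in B)) <= _).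
      rewrite big_split /= sum1_card leq_add2l -sum1_card big_mkcond [X in _ <= X]big_mkcond /=.
      apply: leq_sum => r _; case: (boolP (r \in B)) => // rB.
      by rewrite (subsetP BHB).
    rewrite [X in _ <= X](eq_bigl (fun r => r \in (B * H)%g)); last first.
      move=> r; rewrite andbC; case: (boolP (r \in (B * H)%g)) => //= rBH.
      by apply/negP => rc; move: (disjointFr dis rc); rewrite rBH.
    apply: leq_sum => r rBH; case: (boolP (r \in B)) => [/wB ->//|_].
    by apply: wS; apply: (subsetP BS).
  rewrite -sum1_card; apply: leq_trans (_ : \sum_(r < l | r \in T) w r <= _).
    by apply: leq_sum => r; rewrite !inE => /andP[_ /andP[_ rS]]; apply: wS.
  by rewrite big_mkcond [X in _ <= X]big_mkcond /=; apply: leq_sum => r _;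
     rewrite !in_setD; do !case: (_ \in _).
(* The sum of w is at least 3 |B| - 1 + (|S| + |H| - 2 |B H|), and the bracket is nonnegative by
   [cH]. *)
have := cX _ b1B; have := cX _ b2B; rewrite -/X -/Y.
move: cXY cT cH; rewrite kE sE -/S; move: (\sum_(r < l) _) (\sum_(r < l | _) _).
lia_card.
Qed.
End Freiman.

(** * Dilates of a subset of a prime field *)

Section PrimeField.
Variables (p : nat) (A : {set 'F_p}).
Hypothesis pp : prime p.
Local Open Scope ring_scope.

(** For nonzero u this is the dilate of A by the inverse of u. *)
Definition ind (u : 'F_p) : pred nat := fun x => (x%:R * u \in A).

Lemma val_Fp (x : nat) : val (x%:R : 'F_p) = (x %% p)%N.
Proof. by rewrite /= val_Fp_nat. Qed.

Lemma Fp_natK (x : 'F_p) : (val x)%:R = x.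
Proof. exact: natr_Zp. Qed.

Lemma ltn_Fp (x : 'F_p) : (val x < p)%N.
Proof. by have := ltn_ord x; rewrite [X in (_ < X)%N]Fp_cast. Qed.

Lemma Fp_nat_neq0 x : (0 < x < p)%N -> x%:R != 0 :> 'F_p.
Proof.
move=> /andP[x0 xp]; apply/eqP => /(congr1 val); rewrite val_Fp modn_small //=.
by move=> x00; rewrite x00 in x0.
Qed.

Lemma ind_period u x : ind u (x + p) = ind u x.
Proof. by rewrite /ind natrD pchar_Fp_0 // addr0. Qed.

Lemma ind_sum_free u x y :
  sum_free [set` A]%classic -> ind u x -> ind u y -> ~~ ind u (x + y).
Proof.
move=> sf ax ay; apply/negP => axy; apply: (sf _ _ _ ax ay axy).
by rewrite natrD mulrDl.
Qed.

Lemma cnt_ind u : u != 0 -> cnt (ind u) 0 p = #|A|.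
Proof.
move=> u0; pose phi (i : 'I_p) : 'F_p := (i : nat)%:R * u.
have phi_inj : injective phi.
  move=> i j /(mulIf u0) /(congr1 val).
  by rewrite !val_Fp !modn_small // => /val_inj.
have phi_bij : bijective phi.
  by apply: inj_card_bij => //; rewrite [X in (X <= _)%N]card_Fp // card_ord.
rewrite cnt_card -(on_card_preimset (onW_bij _ phi_bij)).
by apply: eq_card => i; rewrite !inE.
Qed.

End PrimeField.

Lemma cnt_multiples (f : pred nat) g l : (0 < g)%N ->
  (forall x, (x <= g * l)%N -> f x -> (g %| x)%N) ->
  cnt f 0 (g * l).+1 = cnt (fun i => f (g * i)%N) 0 l.+1.
Proof.
move=> g0; elim: l => [|l IH] H; first by rewrite muln0 !cnt1 muln0.
rewrite [in RHS]cntS add0n -IH; last by move=> x xl; apply: H; lia.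
have -> : cnt f 0 (g * l.+1).+1 = (cnt f 0 (g * l).+1 + cnt f (g * l).+1 g)%N.
  by apply: cnt_split; lia.
congr addn; case: g g0 H {IH} => // g _ H.
rewrite cntS (@cnt_eq0 f) => [|i il]; first by congr (nat_of_bool (f _)); lia.
apply/negP => fi; have : (g.+1 %| (g.+1 * l).+1 + i)%N by apply: H => //; lia.
rewrite addSnnS dvdn_addr ?dvdn_mulr // => /(dvdn_leq (ltn0Sn i)).
lia.
Qed.

(** * From a dense half-circle to the whole set *)

Section Arc.
Variables (p h : nat) (A : {set 'F_p}).
Hypothesis pp : prime p.
Hypothesis ph : p = (2 * h).+1.
Hypothesis sf : sum_free [set` A]%classic.
Local Open Scope nat_scope.

(** Freiman's theorem needs gcd 1 and both ends of the hull in the set. So the arc is trimmed to its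
    extreme points, moved to 0 and divided by the gcd g, which replaces u by g u. *)
Lemma arc_structure (u : 'F_p) (a : nat) :
  let n := #|A| in let m := cnt (ind A u) a h.+1 in
  u != 0%R -> 3 * p + 5 < 5 * n + 6 * m -> p + 3 < 3 * m + n ->
  4 * p + 4 <= 9 * m + 6 * n ->
  exists2 v : 'F_p, v != 0%R & forall x, x < p -> ind A v x -> n <= x /\ x <= p - n.
Proof.
move=> n m u0 b1 b2 b3.
have n_le v : v != 0%R -> cnt (ind A v) 0 p = n by apply: cnt_ind.
have np : n <= p by rewrite -(n_le u u0) cnt_size.
have m1 : 2 <= m by lia.
pose Q x := (a <= x <= a + h) && ind A u x.
have exQ : exists x, Q x.
  have [/existsP[i fi]|/existsPn no] := boolP [exists i : 'I_h.+1, ind A u (a + i)].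
    by exists (a + i); rewrite /Q fi; have := ltn_ord i; lia.
  suff : m = 0 by lia.
  by apply: cnt_eq0 => i il; apply: (no (Ordinal il)).
have bQ x : Q x -> x <= a + h by case/andP; lia.
have [x0 /andP[x0a fx0] min0] := ex_minnP exQ.
have [x1 /andP[x1a fx1] max1] := ex_maxnP exQ bQ.
have x01 : x0 <= x1 by apply: min0; rewrite /Q x1a fx1.
set L := x1 - x0; pose f' j := ind A u (x0 + j).
have mE : m = cnt f' 0 L.+1.
  have -> : m = cnt (ind A u) a (x0 - a) + cnt (ind A u) x0 (a + h - x0).+1.
    by apply: cnt_split; lia.
  have -> : cnt (ind A u) x0 (a + h - x0).+1 = cnt (ind A u) x0 L.+1
     + cnt (ind A u) x1.+1 (a + h - x1) by apply: cnt_split; lia.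
  rewrite (@cnt_eq0 _ a) ?(@cnt_eq0 _ x1.+1) => [|i il|i il].
  - by rewrite add0n addn0; apply: eq_cnt.
  - by apply/negP => fi; have := max1 (x1.+1 + i); rewrite /Q fi; lia.
  - by apply/negP => fi; have := min0 (a + i); rewrite /Q fi; lia.
have L0 : 0 < L by have := cnt_size f' 0 L.+1; lia.
have f'0 : f' 0 by rewrite /f' addn0.
have f'L : f' L by rewrite /f' /L subnKC.
set g := \big[gcdn/0]_(j < L.+1 | f' j) (j : nat).
have gdv j : j <= L -> f' j -> g %| j.
  by move=> jL fj; apply: (@biggcdn_inf _ (inord j)); rewrite inordK.
have gL : g %| L by apply: gdv.
have g0 : 0 < g by apply: dvdn_gt0 gL.
pose l := L %/ g; have LE : L = g * l by rewrite mulnC divnK.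
have l0 : 0 < l by move: L0; rewrite LE muln_gt0 => /andP[].
have lL : l <= L by apply: leq_div.
have l2p : (2 * l).+1 <= p by lia.
have gp : 0 < g < p by have := dvdn_leq L0 gL; lia.
have gF : (g%:R != 0 :> 'F_p)%R by apply: Fp_nat_neq0.
pose v : 'F_p := (g%:R * u)%R.
have v0 : v != 0%R by rewrite mulf_neq0.
(* Division in the field: the point y + i for v is the point x0 + g i for u. *)
pose y := val ((x0%:R / g%:R)%R : 'F_p).
have FE i : ind A v (y + i) = f' (g * i).
  rewrite /ind /f' /ind /v natrD Fp_natK natrD natrM !mulrA mulrDl divfK //.
  by rewrite (mulrC (g%:R)%R).
have cF : cnt (fun i => f' (g * i)) 0 l.+1 = m.
  by rewrite mE LE cnt_multiples // -LE.
have per x : ind A v (x + p) = ind A v x by apply: ind_period.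
have vS x z : ind A v x -> ind A v z -> ~~ ind A v (x + z) by apply: ind_sum_free.
(* Sums avoid A, so they are counted inside its complement, which has p - n points per period. *)
have fr := @freiman_3k3 l (fun i => f' (g * i)) (fun s => ~~ ind A v (y + y + s)) l0.
have {fr} : l + m <= p - n.
  have cG : cnt (fun s => ~~ ind A v (y + y + s)) 0 (2 * l).+1 <= p - n.
    have : cnt (ind A v) (y + y) p + cnt (fun s => ~~ ind A v (y + y + s)) 0 p <= p.
      by apply: cnt_pair => i _; rewrite add0n andbN.
    rewrite (cnt_period _ 0 per) n_le //.
    have -> : cnt (fun s => ~~ ind A v (y + y + s)) 0 p =
      cnt (fun s => ~~ ind A v (y + y + s)) 0 (2 * l).+1 +
      cnt (fun s => ~~ ind A v (y + y + s)) (2 * l).+1 (p - (2 * l).+1).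
      by apply: cnt_split; rewrite ?subnKC.
    by move: np; clear; lia.
  case: fr; rewrite ?muln0 -?LE ?cF //.
  - move=> d dv; have : d * g %| g.
      apply/dvdn_biggcdP => j fj; have jL := ltn_ord j.
      have gj := gdv j jL fj; rewrite -(divnK gj) dvdn_pmul2r //; apply: dv.
        by apply: leq_div2r.
      by rewrite mulnC divnK.
    by rewrite -{2}(mul1n g) dvdn_pmul2r // dvdn1 => /eqP.
  - move=> i j _ _; rewrite -!FE => fi fj.
    by have := vS _ _ fi fj; rewrite addnACA.
  - by move=> le; apply: leq_trans le cG.
  - by move: b2 cG np; move: (cnt _ 0 _) => s; clear; lia.
move=> lmn.
exists v => // x xp fx.
have mE' : cnt (ind A v) y l.+1 = m.
  by rewrite -cF; apply: eq_cnt => i _; rewrite FE.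
rewrite -(n_le v v0).
have y0 : ind A v y by rewrite -[y]addn0 FE muln0.
have yl : ind A v (y + l) by rewrite FE -LE.
apply: (@sum_free_interval p (ind A v) per vS y l) => //; rewrite ?mE' ?n_le //.
- by move: b2 lmn np; clear; lia.
- by move: b2; clear; lia.
Qed.

End Arc.

(** * Trigonometric functions *)

Local Open Scope ring_scope.

Section StdlibCos.
Local Open Scope R_scope.

Lemma Rcos_le_taylor4 (x : R) : 0 <= x -> x <= 1 ->
  cos x <= 1 - x * x / 2 + x * x * x * x / 24.
Proof.
move=> x0 x1; have PI3 := PI2_3_2.
have [||_] := @cos_bound x 0; try Lra.lra.
rewrite /cos_approx /cos_term /=; Lra.lra.
Qed.

Lemma RPI_gt3 : INR 3 < PI.
Proof. by have := PI2_3_2; rewrite [INR 3]/=; Lra.lra. Qed.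

Lemma RPI_le4 : PI <= INR 4.
Proof. by have := PI_4; rewrite [INR 4]/=; Lra.lra. Qed.
End StdlibCos.

(* [K] hides Stdlib's [R], whose bound scope would parse the field operations
   as [Rplus], [Rmult], ... *)
Definition K : realFieldType := Rdefinitions.R.
Definition kcos : K -> K := cos.
Definition ksin : K -> K := sin.
Definition kpi : K := PI.

Lemma kpi_gt3 : 3%:R < kpi.
Proof. by have /RltP := RPI_gt3; rewrite INRE. Qed.

Lemma kpi_le4 : kpi <= 4%:R.
Proof. by have /RleP := RPI_le4; rewrite INRE. Qed.

Lemma kcosD (x y : K) : kcos (x + y) = kcos x * kcos y - ksin x * ksin y.
Proof. exact: cos_plus. Qed.

Lemma ksinD (x y : K) : ksin (x + y) = ksin x * kcos y + kcos x * ksin y.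
Proof. exact: sin_plus. Qed.

Lemma kcosN (x : K) : kcos (- x) = kcos x.
Proof. exact: cos_neg. Qed.

Lemma ksinN (x : K) : ksin (- x) = - ksin x.
Proof. exact: sin_neg. Qed.

Lemma kcos0 : kcos 0 = 1.
Proof. exact: cos_0. Qed.

Lemma ksin0 : ksin 0 = 0.
Proof. exact: sin_0. Qed.

Lemma kcos_pi : kcos kpi = -1.
Proof. exact: cos_PI. Qed.

Lemma ksin_pi : ksin kpi = 0.
Proof. exact: sin_PI. Qed.

Lemma kcos_homo (x y : K) : 0 <= x -> x <= y -> y <= kpi -> kcos y <= kcos x.
Proof.
move=> x0 xy yP; have xP := le_trans xy yP; have y0 := le_trans x0 xy.
by move: x0 xP y0 yP xy => /RleP x0 /RleP xP /RleP y0 /RleP yP /RleP xy; apply/RleP/cos_decr_1.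
Qed.

Lemma kcos_sin_sqr (x : K) : kcos x ^+ 2 + ksin x ^+ 2 = 1.
Proof. by rewrite addrC; apply: (sin2_cos2 x). Qed.

Lemma ksin_gt0 (x : K) : 0 < x -> x < kpi -> 0 < ksin x.
Proof. by move=> /RltP x0 /RltP xP; apply/RltP; apply: sin_gt_0. Qed.

Lemma ksin_le_id (x : K) : 0 <= x -> ksin x <= x.
Proof.
rewrite le_eqVlt => /orP[/eqP <-|/RltP x0]; first by rewrite ksin0.
exact/ltW/RltP/sin_lt_x.
Qed.

Lemma kcos_le_taylor4 (x : K) : 0 <= x -> x <= 1 ->
  kcos x <= 1 - x ^+ 2 / 2%:R + x ^+ 4 / 24%:R.
Proof.
move=> /RleP x0 /RleP x1.
have /RleP := Rcos_le_taylor4 x0 x1; rewrite !RdivE (IZRposE 2) (IZRposE 24) !INRE.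
by rewrite -[x ^+ 4]/(x * (x * (x * x))) expr2 !mulrA.
Qed.

#[global] Opaque K kcos ksin kpi.

(** * A large Fourier coefficient *)

Section Characters.
Variable p : nat.
Hypothesis p0 : (0 < p)%N.

Definition angle (x : K) : K := 2%:R * kpi * x / p%:R.
(** [ec] and [es] are the real and imaginary parts of the character exp(2 pi i x / p). *)
Definition ec (x : nat) : K := kcos (angle x%:R).
Definition es (x : nat) : K := ksin (angle x%:R).

Let pR : p%:R != 0 :> K. Proof. by rewrite pnatr_eq0 -lt0n. Qed.

Lemma angleD x y : angle (x + y) = angle x + angle y.
Proof. by rewrite /angle; field. Qed.

Lemma ecD x y : ec (x + y) = ec x * ec y - es x * es y.
Proof. by rewrite /ec /es natrD angleD kcosD. Qed.

Lemma esD x y : es (x + y) = es x * ec y + ec x * es y.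
Proof. by rewrite /ec /es natrD angleD ksinD. Qed.

Lemma ec0 : ec 0 = 1.
Proof. by rewrite /ec /angle mulr0 mul0r; exact: kcos0. Qed.

Lemma es0 : es 0 = 0.
Proof. by rewrite /es /angle mulr0 mul0r; exact: ksin0. Qed.

Lemma angle_p : angle p%:R = kpi + kpi.
Proof. by rewrite /angle; field. Qed.

Lemma ecp : ec p = 1.
Proof. by rewrite /ec angle_p kcosD kcos_pi ksin_pi; ring. Qed.

Lemma esp : es p = 0.
Proof. by rewrite /es angle_p ksinD kcos_pi ksin_pi; ring. Qed.

Lemma ec_period x : ec (x + p) = ec x.
Proof. by rewrite ecD ecp esp; ring. Qed.

Lemma es_period x : es (x + p) = es x.
Proof. by rewrite esD ecp esp; ring. Qed.

Lemma ec_addM x k : ec (x + k * p) = ec x.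
Proof. by elim: k => [|k IH]; rewrite ?addn0 // mulSnr addnA ec_period. Qed.

Lemma es_addM x k : es (x + k * p) = es x.
Proof. by elim: k => [|k IH]; rewrite ?addn0 // mulSnr addnA es_period. Qed.

Lemma ec_mod z x : ec (z * (x %% p)) = ec (z * x).
Proof. by rewrite [in RHS](divn_eq x p) mulnDr mulnA addnC ec_addM. Qed.

Lemma es_mod z x : es (z * (x %% p)) = es (z * x).
Proof. by rewrite [in RHS](divn_eq x p) mulnDr mulnA addnC es_addM. Qed.

(** Telescoping of 2 sin t cos y = sin(y + t) - sin(y - t), with t half the angle of k. *)
Lemma sum_ec k : (0 < k < p)%N -> \sum_(z < p) ec (z * k) = 0.
Proof.
move=> /andP[k0 kp].
pose t : K := angle k%:R / 2%:R.
have kR : 0 < k%:R :> K by rewrite ltr0n.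
have kpR : k%:R < p%:R :> K by rewrite ltr_nat.
have P0 : 0 < kpi :> K by have := kpi_gt3; lra.
have tE : t = kpi * (k%:R / p%:R) by rewrite /t /angle; field.
have s0 : 0 < ksin t.
  rewrite tE; apply: ksin_gt0; first by rewrite mulr_gt0 // divr_gt0 // ltr0n.
  by rewrite -[X in _ < X]mulr1 ltr_pM2l // ltr_pdivrMr ?mul1r // ltr0n.
pose u (z : nat) : K := ksin (angle (z * k)%:R - t).
have step z : 2%:R * ksin t * ec (z * k) = u z.+1 - u z.
  have e : angle (z.+1 * k)%:R - t = angle (z * k)%:R + t.
    by rewrite mulSn natrD angleD (_ : angle k%:R = t + t) /t; field.
  by rewrite /u e !ksinD ksinN kcosN /ec; ring.
have : \sum_(z < p) (u z.+1 - u z) = u p - u 0%N.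
  by rewrite -(big_mkord xpredT (fun z => u z.+1 - u z)) telescope_sumr.
under eq_bigr do rewrite -step.
rewrite -mulr_sumr => h; apply/eqP; move/eqP: h.
have -> : u p - u 0%N = 0.
  have uE z : u z = es (z * k) * kcos t - ec (z * k) * ksin t.
    by rewrite /u ksinD ksinN kcosN mulrN.
  by rewrite !uE mul0n mulnC -[(k * p)%N]add0n ec_addM es_addM ec0 es0; ring.
by rewrite mulf_eq0 gt_eqF //= mulr_gt0 // ltr0n.
Qed.

(** This is cos(2 pi z (x - y) / p), without subtraction in [nat]. *)
Definition corr (z x y : nat) : K := ec (z * x) * ec (z * y) + es (z * x) * es (z * y).

Lemma corrC z x y : corr z x y = corr z y x.
Proof. by rewrite /corr; ring. Qed.

Lemma corr_mod z x y : corr z (x %% p) y = corr z x y.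
Proof. by rewrite /corr ec_mod es_mod. Qed.

Lemma ec_sqr x : ec x ^+ 2 + es x ^+ 2 = 1.
Proof. exact: kcos_sin_sqr. Qed.

Lemma sum_corr_eq x : \sum_(z < p) corr z x x = p%:R.
Proof.
rewrite (eq_bigr (fun=> 1)) => [|z _]; last by rewrite /corr -!expr2 ec_sqr.
by rewrite sumr_const card_ord.
Qed.

Lemma sum_corr_lt x y : (x < y < p)%N -> \sum_(z < p) corr z x y = 0.
Proof.
move=> /andP[xy yp]; rewrite -[RHS](@sum_ec (y - x)%N); last by lia.
apply: eq_bigr => z _; rewrite /corr -{1 2}(subnK (ltnW xy)) mulnDr ecD esD.
have := ec_sqr (z * x); move: (ec (z * (y - x))) (es (z * (y - x))) (ec _) (es _).
move=> a b c d h.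
have -> : c * (a * c - b * d) + d * (b * c + a * d) = a * (c ^+ 2 + d ^+ 2) by ring.
by rewrite h mulr1.
Qed.

Lemma sum_corr_neq x y : (x < p)%N -> (y < p)%N -> x != y -> \sum_(z < p) corr z x y = 0.
Proof.
move=> xp yp; case: ltngtP => // h _; first by rewrite sum_corr_lt ?h.
by under eq_bigr do rewrite corrC; rewrite sum_corr_lt ?h.
Qed.

(** * The Fourier transform of a sum-free set *)

Variable f : pred nat.
Hypothesis fP : forall x, f (x + p)%N = f x.
Hypothesis fS : forall x y, f x -> f y -> ~~ f (x + y)%N.
Let n := cnt f 0 p.

Definition fourier_re z : K := \sum_(x < p | f x) ec (z * x).
Definition fourier_im z : K := \sum_(x < p | f x) es (z * x).
Definition fourier_sqr z : K := fourier_re z ^+ 2 + fourier_im z ^+ 2.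

Lemma natr_cnt : n%:R = \sum_(x < p | f x) 1 :> K.
Proof.
rewrite /n /cnt natr_sum [RHS]big_mkcond; apply: eq_bigr => i _.
by rewrite add0n; case: (f i).
Qed.

Lemma fourier_sqr_ge0 z : 0 <= fourier_sqr z.
Proof. by rewrite addr_ge0 // sqr_ge0. Qed.

Lemma fourier_sqrE z : fourier_sqr z = \sum_(x < p | f x) \sum_(y < p | f y) corr z x y.
Proof.
rewrite /fourier_sqr !expr2 !big_distrlr -big_split /=; apply: eq_bigr => x _.
by rewrite -big_split.
Qed.

Lemma sum_fourier_sqr : \sum_(z < p) fourier_sqr z = p%:R * n%:R.
Proof.
under eq_bigr do rewrite fourier_sqrE.
rewrite exchange_big natr_cnt mulr_sumr /=; apply: eq_bigr => x fx.
rewrite exchange_big (bigD1 x) //= sum_corr_eq big1 ?addr0 ?mulr1 //.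
by move=> y /andP[_ yx]; rewrite sum_corr_neq // eq_sym.
Qed.

(** Both sides are the real part of the squared transform times its conjugate. *)
Lemma fourier_cube z : fourier_sqr z * fourier_re z =
  \sum_(x < p | f x) \sum_(y < p | f y) \sum_(w < p | f w) corr z (x + y) w.
Proof.
have -> : fourier_sqr z * fourier_re z =
    (fourier_re z * fourier_re z - fourier_im z * fourier_im z) * fourier_re z +
    (fourier_im z * fourier_re z + fourier_re z * fourier_im z) * fourier_im z.
  by rewrite /fourier_sqr; ring.
have -> : fourier_re z * fourier_re z - fourier_im z * fourier_im z =
    \sum_(x < p | f x) \sum_(y < p | f y) ec (z * (x + y)).
  rewrite !big_distrlr -sumrB /=; apply: eq_bigr => x _; rewrite -sumrB.
  by apply: eq_bigr => y _; rewrite mulnDr ecD.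
have -> : fourier_im z * fourier_re z + fourier_re z * fourier_im z =
    \sum_(x < p | f x) \sum_(y < p | f y) es (z * (x + y)).
  rewrite !big_distrlr -big_split /=; apply: eq_bigr => x _; rewrite -big_split /=.
  by apply: eq_bigr => y _; rewrite mulnDr esD.
rewrite !mulr_suml -big_split /=; apply: eq_bigr => x _.
rewrite !mulr_suml -big_split /=; apply: eq_bigr => y _.
by rewrite !mulr_sumr -big_split.
Qed.

Lemma periodic_mod x : f (x %% p)%N = f x.
Proof.
rewrite [in RHS](divn_eq x p) addnC; elim: (x %/ p)%N => [|k IH]; first by rewrite addn0.
by rewrite mulSnr addnA fP.
Qed.

(** By orthogonality the sum is p times the number of triples in A with x + y = w. *)
Lemma sum_fourier_cube : \sum_(z < p) fourier_sqr z * fourier_re z = 0.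
Proof.
under eq_bigr do rewrite fourier_cube.
rewrite exchange_big big1 //= => x fx; rewrite exchange_big big1 //= => y fy.
rewrite exchange_big big1 //= => w fw; under eq_bigr do rewrite -corr_mod.
rewrite sum_corr_neq ?ltn_pmod //; apply/eqP => e.
by have := fS fx fy; rewrite -periodic_mod e fw.
Qed.

Lemma fourier_re0 : fourier_re 0 = n%:R.
Proof. by rewrite natr_cnt; apply: eq_bigr => x _; rewrite mul0n ec0. Qed.

Lemma fourier_im0 : fourier_im 0 = 0.
Proof. by apply: big1 => x _; rewrite mul0n es0. Qed.

(** The constant 0.1482 is just below n^2 / (p (p - n)) at n = 0.318 p. If no z worked, the sum over
    nonzero z of the squared modulus times (real part + s) would be nonnegative, yet it is n (s (p -
    n) - n^2) < 0. *)
Lemma large_coefficient : (318%:R / 1000%:R * p%:R < n%:R :> K) ->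
  exists2 z : nat, (0 < z < p)%N & fourier_re z <= - (741%:R / 5000%:R) * p%:R.
Proof.
move=> big.
have [/existsP[z /andP[z0 hz]]|/existsPn no] :=
  boolP [exists z : 'I_p, (0 < z)%N && (fourier_re z <= - (741%:R / 5000%:R) * p%:R)].
  by exists z; rewrite // z0 ltn_ord.
exfalso; pose s : K := 741%:R / 5000%:R * p%:R.
have pR0 : 0 < p%:R :> K by rewrite ltr0n.
have np : n%:R <= p%:R :> K by rewrite ler_nat cnt_size.
have : 0 <= \sum_(z < p | z != Ordinal p0) fourier_sqr z * (fourier_re z + s).
  apply: sumr_ge0 => z z0; apply: mulr_ge0; first exact: fourier_sqr_ge0.
  have := no z; rewrite negb_and -leqNgt leqn0 -ltNge.
  have -> : ((z : nat) == 0%N) = false by apply/negP => h; case/negP: z0; apply/eqP/val_inj/eqP.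
  by rewrite /s /=; lra.
have t1 := sum_fourier_sqr; have t2 := sum_fourier_cube.
rewrite (bigD1 (Ordinal p0)) //= {1}/fourier_sqr fourier_re0 fourier_im0 in t1.
rewrite (bigD1 (Ordinal p0)) //= {1}/fourier_sqr fourier_re0 fourier_im0 in t2.
under eq_bigr do rewrite mulrDr.
rewrite big_split /= -mulr_suml.
move: t1 t2; move: (\sum_(i < p | _) fourier_sqr _) (\sum_(i < p | _) _ * _) => w1 w2 t1 t2.
have -> : w1 = p%:R * n%:R - n%:R ^+ 2 by rewrite -t1; ring.
have -> : w2 = - n%:R ^+ 3 by apply/eqP; rewrite -subr_eq0 -t2; apply/eqP; ring.
rewrite /s; move: big np pR0; move: (n%:R : K) (p%:R : K) => N P big np pR0 h.
have N0 : 0 < N by lra.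
have : 0 <= N * (741%:R / 5000%:R * P * (P - N) - N ^+ 2).
  by apply: le_trans h _; rewrite le_eqVlt; apply/orP; left; apply/eqP; ring.
rewrite pmulr_rge0 //.
nra.
Qed.

End Characters.

(** * From a Fourier coefficient to a dense half-circle *)

(* Close to the optimal level [cos (pi * (2 * 0.2352 - 0.318))]. *)
Definition clamp_level : K := 89%:R / 100%:R.
Definition clamp (t : K) : K := if t <= - clamp_level then - clamp_level else if clamp_level <= t then clamp_level else t.
Definition pospart (t : K) : K := if 0 <= t then t else 0.

Lemma clamp_homo a b : a <= b -> clamp a <= clamp b.
Proof. by move=> ab; rewrite /clamp /clamp_level; do !case: ifP => //; lra. Qed.

Lemma clamp_lip a b d : 0 <= d -> a - b <= d -> clamp a - clamp b <= d.
Proof. by move=> d0 ab; rewrite /clamp /clamp_level; do !case: ifP => //; lra. Qed.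

Lemma clamp_ge t : - clamp_level <= clamp t.
Proof. by rewrite /clamp /clamp_level; do !case: ifP => //; lra. Qed.

Lemma clamp_le t : clamp t <= clamp_level.
Proof. by rewrite /clamp /clamp_level; do !case: ifP => //; lra. Qed.

Lemma clampN t : clamp (- t) = - clamp t.
Proof. by rewrite /clamp /clamp_level; do !case: ifP => //; lra. Qed.

Lemma le_clamp_pospart t : t <= clamp t + pospart (t - clamp_level).
Proof. by rewrite /clamp /pospart /clamp_level; do !case: ifP => //; lra. Qed.

Lemma pospart_ge0 t : 0 <= pospart t.
Proof. by rewrite /pospart; case: ifP. Qed.

Lemma sum_shift (p : nat) (F : nat -> K) s :
  (forall x, F (x + p)%N = F x) -> \sum_(x < p) F (x + s)%N = \sum_(x < p) F x.
Proof.
move=> FP; elim: s => [|s IH]; first by apply: eq_bigr => x _; rewrite addn0.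
rewrite -IH.
have : \sum_(x < p.+1) F (x + s)%N = \sum_(x < p) F (x + s)%N + F (p + s)%N.
  by rewrite big_ord_recr.
rewrite big_ord_recl /= add0n [(p + s)%N]addnC FP addrC => /addIr <-.
by apply: eq_bigr => x _; rewrite addSnnS.
Qed.

(** * Cosine sums of sets that are sparse in every half-circle *)

Section Clamp.
Variables (p h M : nat) (f : pred nat).
Hypothesis ph : p = (2 * h).+1.
Hypothesis fP : forall x, f (x + p)%N = f x.
Hypothesis arcs : forall a, (cnt f a h.+1 <= M)%N.
Let n := cnt f 0 p.
Let p0 : (0 < p)%N. Proof. by rewrite ph. Qed.
Let pR : 0 < p%:R :> K. Proof. by rewrite ltr0n. Qed.
Let pE : p%:R = 2%:R * h%:R + 1 :> K.
Proof. by rewrite ph -addn1 natrD natrM. Qed.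

(** The sign puts the peak at p / 2, midway between h and h + 1. *)
Definition ncos (x : nat) : K := - ec p x.
Definition half_clamp (x : nat) : K := clamp (ncos x) / 2%:R.

Lemma ncos_period x : ncos (x + p) = ncos x.
Proof. by rewrite /ncos ec_period. Qed.

Lemma half_clamp_period x : half_clamp (x + p) = half_clamp x.
Proof. by rewrite /half_clamp ncos_period. Qed.

Lemma angle_ge0 x : 0 <= x -> 0 <= angle p x.
Proof.
move=> x0; apply: divr_ge0; last exact: ler0n.
by apply: mulr_ge0 => //; have := kpi_gt3; lra.
Qed.

Lemma angle_le x y : x <= y -> angle p x <= angle p y.
Proof.
move=> xy; rewrite /angle ler_pM2r ?invr_gt0 // ler_pM2l //.
by have := kpi_gt3; lra.
Qed.

Lemma angle_half : angle p (h%:R + 1 / 2%:R) = kpi.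
Proof. by rewrite /angle pE; field; rewrite -pE gt_eqF. Qed.

Lemma ncos_le x : (x < h)%N -> ncos x <= ncos x.+1.
Proof.
move=> xh; rewrite lerN2; apply: kcos_homo.
- by rewrite angle_ge0.
- by rewrite angle_le // ler_nat.
- rewrite -angle_half angle_le //.
  have : x.+1%:R <= h%:R :> K by rewrite ler_nat.
  lra.
Qed.

Lemma ncos_sym x : (x <= p)%N -> ncos (p - x) = ncos x.
Proof.
move=> xp; rewrite /ncos /ec natrB // (angleD p0) angle_p // kcosD.
have -> : angle p (- x%:R) = - angle p x%:R by rewrite /angle mulrN mulNr.
by rewrite kcosN kcosD ksinD kcos_pi ksin_pi ksinN; ring.
Qed.

Lemma ncos_ge x : (h <= x < p)%N -> ncos x.+1 <= ncos x.
Proof.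
move=> /andP[hx xp].
have -> : ncos x.+1 = ncos (p - x.+1) by rewrite ncos_sym.
have [->|xh] := eqVneq x h.
  by rewrite (_ : (p - h.+1)%N = h) // ph; lia.
rewrite -[X in _ <= X]ncos_sym; last by rewrite ltnW.
have -> : (p - x = (p - x.+1).+1)%N by lia.
by apply: ncos_le; lia.
Qed.

Let half_clamp_le x : (x < h)%N -> 0 <= half_clamp x.+1 - half_clamp x.
Proof. by move=> /ncos_le /clamp_homo; rewrite /half_clamp; lra. Qed.

Let half_clamp_ge x : (h <= x < p)%N -> half_clamp x.+1 - half_clamp x <= 0.
Proof. by move=> /ncos_ge /clamp_homo; rewrite /half_clamp; lra. Qed.

Let N k : K := (cnt f k h)%:R.

Lemma arc_count_diff k : (f k)%:R - (f (k + h)%N)%:R = N k - N k.+1.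
Proof.
have : (cnt f k h + f (k + h) = f k + cnt f k.+1 h)%N.
  by rewrite -cntS (@cnt_split f k k.+1 _ 1 h) ?addn1 ?add1n // cnt1.
by move/(congr1 (fun i => i%:R : K)); rewrite /N !natrD; lra.
Qed.

Lemma arc_count_le k : N k <= M%:R.
Proof. by rewrite ler_nat; apply: leq_trans (arcs k); rewrite cntS leq_addr. Qed.

(** The complementary arc has h + 1 places, hence at most M points. *)
Lemma arc_count_ge k : n%:R - M%:R <= N k.
Proof.
rewrite lerBlDr -natrD ler_nat /n (cnt_period 0 k fP).
rewrite (@cnt_split f k (k + h) p h h.+1) // ?leq_add2l ?arcs //.
by rewrite ph; lia.
Qed.

(** A shift by h makes f x - f (x + h) appear, a difference of arc counts. Summation by parts leaves
    the increments of [half_clamp], nonnegative up to h and nonpositive after, against counts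
    between n - M and M. *)
Lemma clamp_sum :
  \sum_(x < p) (f x)%:R * (half_clamp x - half_clamp (x + h.+1)) <= (2%:R * M%:R - n%:R) * clamp_level.
Proof.
have -> : \sum_(x < p) (f x)%:R * (half_clamp x - half_clamp (x + h.+1)) =
          \sum_(x < p) half_clamp x * (N x - N x.+1).
  under eq_bigr do rewrite mulrBr.
  rewrite sumrB -(@sum_shift p (fun x => (f x)%:R * half_clamp (x + h.+1)) h); last first.
    by move=> x; rewrite fP addnAC half_clamp_period.
  rewrite -sumrB; apply: eq_bigr => x _.
  have -> : (x + h + h.+1 = x + p)%N by lia.
  by rewrite half_clamp_period -arc_count_diff; ring.
have -> : \sum_(x < p) half_clamp x * (N x - N x.+1) = \sum_(x < p) (half_clamp x.+1 - half_clamp x) * N x.+1.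
  apply/eqP; rewrite -subr_eq0 -sumrB.
  rewrite (eq_bigr (fun x : 'I_p => - (half_clamp x.+1 * N x.+1 - half_clamp x * N x))); last first.
    by move=> x _; ring.
  rewrite sumrN -(big_mkord xpredT (fun x => half_clamp x.+1 * N x.+1 - half_clamp x * N x)).
  rewrite telescope_sumr // -[p in half_clamp p]add0n half_clamp_period.
  have -> : N p = N 0 by rewrite /N; congr _%:R; apply: eq_cnt => i _; rewrite add0n addnC fP.
  by rewrite subrr oppr0.
rewrite -(big_mkord xpredT (fun x => (half_clamp x.+1 - half_clamp x) * N x.+1)).
rewrite (@big_cat_nat _ _ _ h) //=; last by rewrite ph; lia.
have s1 : \sum_(0 <= x < h) (half_clamp x.+1 - half_clamp x) * N x.+1 <= (half_clamp h - half_clamp 0) * M%:R.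
  rewrite -(telescope_sumr half_clamp (leq0n h)) mulr_suml big_nat [X in _ <= X]big_nat.
  by apply: ler_sum => x /andP[_ xh]; apply: ler_wpM2l; rewrite ?half_clamp_le ?arc_count_le.
have s2 : \sum_(h <= x < p) (half_clamp x.+1 - half_clamp x) * N x.+1 <= (half_clamp p - half_clamp h) * (n%:R - M%:R).
  have hp : (h <= p)%N by rewrite ph; lia.
  rewrite -(telescope_sumr half_clamp hp) mulr_suml big_nat [X in _ <= X]big_nat.
  by apply: ler_sum => x xh; apply: ler_wnM2l; rewrite ?half_clamp_ge ?arc_count_ge.
have CLp : half_clamp p = half_clamp 0 by rewrite -[p in LHS]add0n half_clamp_period.
apply: le_trans (lerD s1 s2) _; rewrite CLp.
have -> : (half_clamp h - half_clamp 0) * M%:R + (half_clamp 0 - half_clamp h) * (n%:R - M%:R)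
  = (2%:R * M%:R - n%:R) * (half_clamp h - half_clamp 0) by ring.
apply: ler_wpM2l; first by have := arc_count_le 0; have := arc_count_ge 0; lra.
by have := clamp_le (ncos h); have := clamp_ge (ncos 0); rewrite /half_clamp; lra.
Qed.

Lemma ncos_antipode x : ncos (x + h.+1) = kcos (angle p (x%:R + 1 / 2%:R)).
Proof.
rewrite /ncos /ec natrD -addn1 natrD.
have -> : x%:R + (h%:R + 1) = (x%:R + 1 / 2%:R) + (h%:R + 1 / 2%:R) :> K by field.
by rewrite (angleD p0) angle_half kcosD kcos_pi ksin_pi; ring.
Qed.

(* [half_clamp (x + h.+1)] is [- half_clamp x] up to the half-step between
   [x + h.+1] and the antipode of [x]. *)
Lemma clamp_half_clamp x : clamp (ncos x) <= half_clamp x - half_clamp (x + h.+1) + 2%:R / p%:R.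
Proof.
suff : clamp (ncos x) - clamp (- ncos (x + h.+1)) <= 4%:R / p%:R.
  by rewrite clampN /half_clamp; lra.
apply: clamp_lip; first by rewrite divr_ge0 // ltW.
rewrite opprK ncos_antipode /ncos /ec.
(* With [a] the midpoint, the cosines are taken at a - d and a + d and differ by 2 sin a sin d in
   absolute value. *)
pose d : K := angle p (1 / 4%:R).
have d0 : 0 <= d by apply: angle_ge0; lra.
pose a : K := angle p x%:R + d.
have -> : angle p x%:R = a - d by rewrite /a addrK.
have -> : angle p (x%:R + 1 / 2%:R) = a + d.
  rewrite /a (angleD p0) -addrA; congr (_ + _).
  by rewrite /d -(angleD p0); congr (angle p _); field.
rewrite !kcosD kcosN ksinN.
suff : - 2%:R * (ksin a * ksin d) <= 4%:R / p%:R by lra.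
have sd := ksin_le_id d0.
have d4 : d <= 2%:R / p%:R.
  rewrite /d /angle ler_pM2r ?invr_gt0 //; have := kpi_le4; lra.
have sd0 : 0 <= ksin d.
  have [->|dn] := eqVneq d 0; first by rewrite ksin0.
  apply/ltW/ksin_gt0; first by rewrite lt_def dn.
  rewrite -angle_half /d /angle ltr_pM2r ?invr_gt0 // ltr_pM2l; last by have := kpi_gt3; lra.
  have : 0 <= h%:R :> K by rewrite ler0n.
  lra.
have sa : - 1 <= ksin a by have := kcos_sin_sqr a; nra.
have dd : 4%:R / p%:R = 2%:R * (2%:R / p%:R) :> K by field; rewrite gt_eqF.
by rewrite dd; nra.
Qed.

(** * The part of the cosine above the clamping level *)

Definition peak_cos (i : nat) : K := kcos (angle p (i%:R + 1 / 2%:R)).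

(** h - i and h + 1 + i are both at distance i + 1/2 from the peak. *)
Lemma ncos_low i : (i <= h)%N -> ncos (h - i) = peak_cos i.
Proof.
move=> ih; rewrite -ncos_sym; last by rewrite ph; lia.
by rewrite /peak_cos -ncos_antipode; congr ncos; rewrite ph; lia.
Qed.

Lemma sum_pospart_ncos :
  \sum_(x < p) pospart (ncos x - clamp_level) <= 2%:R * \sum_(i < h.+1) pospart (peak_cos i - clamp_level).
Proof.
rewrite -(big_mkord xpredT (fun x => pospart (ncos x - clamp_level))).
rewrite (@big_cat_nat _ _ _ h.+1) //=; last by rewrite ph; lia.
have -> : \sum_(0 <= i < h.+1) pospart (ncos i - clamp_level) = \sum_(i < h.+1) pospart (peak_cos i - clamp_level).
  rewrite big_nat_rev big_mkord; apply: eq_bigr => i _.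
  by rewrite add0n subSS ncos_low // -ltnS.
have -> : \sum_(h.+1 <= i < p) pospart (ncos i - clamp_level) = \sum_(i < h) pospart (peak_cos i - clamp_level).
  rewrite -{1}[h.+1]add0n big_addn (_ : (p - h.+1)%N = h); last by rewrite ph; lia.
  by rewrite big_mkord; apply: eq_bigr => i _; rewrite ncos_antipode.
have := pospart_ge0 (peak_cos h - clamp_level); rewrite big_ord_recr /=.
by move: (\sum_(i < h) _) => s; lra.
Qed.

(** The cut-off lies between 0.079 p and 0.0791 p, just past the point where cos(6 v) falls to
    0.89. *)
Variable I0 : nat.
Hypothesis I0_ge : (79 * p <= 1000 * I0)%N.
Hypothesis I0_le : (1000 * (10 * I0) <= 791 * p)%N.

(* The Taylor bound of [cos (6 * v) - clamp_level], raised by 0.0006 so that it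
   stays nonnegative up to [v = 0.0791]. *)
Let peak_poly (v : K) : K := 553%:R / 5000%:R - 18%:R * v ^+ 2 + 54%:R * v ^+ 4.

(** As pi > 3, this trades pi for a rational before the Taylor bound. *)
Lemma cos_le6 v : 0 <= v -> v <= 1 / 2%:R -> kcos (2%:R * kpi * v) <= kcos (6%:R * v).
Proof.
move=> v0 v1; have P3 := kpi_gt3.
have h1 : 0 <= (kpi - 3%:R) * v by apply: mulr_ge0 => //; lra.
have h2 : 0 <= kpi * (1 / 2%:R - v) by apply: mulr_ge0; lra.
by apply: kcos_homo; lra.
Qed.

Lemma pospart_peak_le i : (i <= h)%N ->
  pospart (peak_cos i - clamp_level) <= if (i < I0)%N then peak_poly ((i%:R + 1 / 2%:R) / p%:R) else 0.
Proof.
move=> ih; set v : K := (i%:R + 1 / 2%:R) / p%:R.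
have iR : 0 <= i%:R :> K by rewrite ler0n.
have v0 : 0 <= v by rewrite divr_ge0 //; lra.
have v1 : v <= 1 / 2%:R.
  rewrite /v ler_pdivrMr // pE; have : i%:R <= h%:R :> K by rewrite ler_nat.
  lra.
have QE : peak_cos i = kcos (2%:R * kpi * v) by rewrite /peak_cos /angle -mulrA.
have Q6 : peak_cos i <= kcos (6%:R * v) by rewrite QE cos_le6.
case: ifP => [iI|/negbT].
  have vI : v <= 791%:R / 1000%:R / 10%:R.
    rewrite /v ler_pdivrMr //; have : 1000%:R * (10%:R * I0%:R) <= 791%:R * p%:R :> K.
      by rewrite -!natrM ler_nat.
    have : i%:R + 1 <= I0%:R :> K by rewrite natr1 ler_nat.
    lra.
  have := @kcos_le_taylor4 (6%:R * v).
  have -> : (6%:R * v) ^+ 2 / 2%:R = 18%:R * v ^+ 2 by field.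
  have -> : (6%:R * v) ^+ 4 / 24%:R = 54%:R * v ^+ 4 by field.
  move=> /(_ ltac:(lra) ltac:(lra)) t4.
  have y0 : v ^+ 2 <= (791%:R / 1000%:R / 10%:R) ^+ 2 by rewrite ler_pXn2r // nnegrE; lra.
  have y1 : 0 <= v ^+ 4 by rewrite exprn_ge0.
  rewrite /pospart /peak_poly /clamp_level; case: ifP => _; first by lra.
  have -> : v ^+ 4 = v ^+ 2 * v ^+ 2 by ring.
  by have := sqr_ge0 v; nra.
rewrite -leqNgt => Ii.
have vI : 79%:R / 1000%:R <= v.
  rewrite /v ler_pdivlMr //; have : 79%:R * p%:R <= 1000%:R * I0%:R :> K.
    by rewrite -!natrM ler_nat.
  have : I0%:R <= i%:R :> K by rewrite ler_nat.
  lra.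
have : kcos (6%:R * v) <= kcos (6%:R * (79%:R / 1000%:R)).
  by apply: kcos_homo; have := kpi_gt3; lra.
have := @kcos_le_taylor4 (6%:R * (79%:R / 1000%:R)).
move=> /(_ ltac:(lra) ltac:(lra)) t4 t5.
rewrite /pospart /clamp_level; case: ifP => // hp; lra.
Qed.

(** Midpoint rule for p times the integral of [peak_poly] up to I / p. The quadratic term has the
    exact error 3 I / (2 p^2); the quartic term is convex, so its midpoint sum is too small. *)
Lemma sum_peak_poly I : \sum_(i < I) peak_poly ((i%:R + 1 / 2%:R) / p%:R) <=
  p%:R * (553%:R / 5000%:R * (I%:R / p%:R) - 6%:R * (I%:R / p%:R) ^+ 3
          + 108%:R / 10%:R * (I%:R / p%:R) ^+ 5) + 3%:R / 2%:R * I%:R / p%:R ^+ 2.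
Proof.
have pn0 : p%:R != 0 :> K by rewrite gt_eqF.
elim: I => [|I IH]; first by rewrite big_ord0 !mul0r !expr0n /= !mulr0; lra.
rewrite big_ord_recr /=; apply: le_trans (lerD IH (lexx _)) _.
rewrite -subr_ge0 -[I.+1%:R]natr1 /peak_poly.
set x : K := I%:R; have x0 : 0 <= x by rewrite ler0n.
set P : K := p%:R.
set D := (X in 0 <= X).
have -> : D = 108%:R / 10%:R * (5%:R / 2%:R * (x + 1 / 2%:R) ^+ 2 + 1 / 16%:R) / P ^+ 4.
  by rewrite /D; field.
apply: divr_ge0; last by rewrite exprn_ge0 // ler0n.
by have := sqr_ge0 (x + 1 / 2%:R); lra.
Qed.

Lemma sum_pospart_le : (1000 * 10 <= p)%N ->
  \sum_(x < p) pospart (ncos x - clamp_level) <= 583%:R / 1000%:R / 50%:R * p%:R + 2%:R.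
Proof.
move=> pbig; apply: le_trans sum_pospart_ncos _.
have w1 : I0%:R / p%:R <= 791%:R / 1000%:R / 10%:R :> K.
  rewrite ler_pdivrMr //; have : 1000%:R * (10%:R * I0%:R) <= 791%:R * p%:R :> K.
    by rewrite -!natrM ler_nat.
  lra.
have w2 : 79%:R / 1000%:R <= I0%:R / p%:R :> K.
  rewrite ler_pdivlMr //; have : 79%:R * p%:R <= 1000%:R * I0%:R :> K.
    by rewrite -!natrM ler_nat.
  lra.
have b6 : 3%:R / 2%:R * I0%:R / p%:R ^+ 2 <= 1 :> K.
  have -> : 3%:R / 2%:R * I0%:R / p%:R ^+ 2 = 3%:R / 2%:R * (I0%:R / p%:R * p%:R^-1) :> K.
    by field; rewrite gt_eqF.
  have : I0%:R / p%:R * p%:R^-1 <= 791%:R / 1000%:R / 10%:R * 1 :> K.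
    apply: ler_pM => //; [by lra | by rewrite invr_ge0 ltW |].
    by rewrite invf_le1 // ler1n.
  by move: (I0%:R / p%:R * p%:R^-1) => r; lra.
have b4 : \sum_(i < h.+1) pospart (peak_cos i - clamp_level) <= \sum_(i < I0) peak_poly ((i%:R + 1 / 2%:R) / p%:R).
  have Ih : (I0 <= h.+1)%N by move: I0_le; rewrite ph; clear; lia.
  rewrite (big_ord_widen _ (fun i => peak_poly ((i%:R + 1 / 2%:R) / p%:R)) Ih) [X in _ <= X]big_mkcond.
  by apply: ler_sum => i _; apply: pospart_peak_le; rewrite -ltnS.
move: (sum_peak_poly I0); set w : K := I0%:R / p%:R in w1 w2 *; set g5 : K := 553%:R / _ * w - _ + _ => b5.
have g5le : g5 <= 583%:R / 1000%:R / 100%:R.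
  have w3 : (79%:R / 1000%:R) ^+ 3 <= w ^+ 3 by rewrite ler_pXn2r // nnegrE; lra.
  have w5 : w ^+ 5 <= (791%:R / 1000%:R / 10%:R) ^+ 5 by rewrite ler_pXn2r // nnegrE; lra.
  by rewrite /g5; lra.
have pg : p%:R * g5 <= p%:R * (583%:R / 1000%:R / 100%:R) by rewrite ler_pM2l.
by move: b4 b5 b6 pg; lra.
Qed.

(** For M <= 0.2352 p the bound is (0.4704 - 0.318) 0.89 p + 0.01166 p + 4, about 0.1473 p + 4,
    which is below 0.1482 p. *)
Lemma cos_sum_le : (1000 * 10 <= p)%N -> (625 * M <= 147 * p)%N ->
  318%:R / 1000%:R * p%:R < n%:R :> K ->
  - (741%:R / 5000%:R) * p%:R < \sum_(x < p | f x) ec p x.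
Proof.
move=> pbig Mle nbig.
have np : n%:R <= p%:R :> K by rewrite ler_nat cnt_size.
suff : \sum_(x < p) (f x)%:R * ncos x < 741%:R / 5000%:R * p%:R.
  rewrite (_ : \sum_(x < p) _ = - \sum_(x < p | f x) ec p x); first by lra.
  rewrite -sumrN [RHS]big_mkcond; apply: eq_bigr => x _.
  by rewrite /ncos; case: (f x); rewrite ?mul1r ?mul0r.
have b1 : \sum_(x < p) (f x)%:R * ncos x <=
   \sum_(x < p) (f x)%:R * (half_clamp x - half_clamp (x + h.+1)) + 2%:R + \sum_(x < p) pospart (ncos x - clamp_level).
  have -> : 2%:R = \sum_(x < p) 2%:R / p%:R :> K.
    by rewrite sumr_const card_ord -[RHS]mulr_natr divfK // gt_eqF.
  rewrite -!big_split /=; apply: ler_sum => x _.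
  have := le_clamp_pospart (ncos x); have := clamp_half_clamp x; have := pospart_ge0 (ncos x - clamp_level).
  have : 0 <= 2%:R / p%:R :> K by rewrite divr_ge0 // ltW.
  by case: (f x) => /=; rewrite ?mul1r ?mul0r; lra.
have b2 := clamp_sum; have b3 := sum_pospart_le pbig.
have p10 : 1000%:R * 10%:R <= p%:R :> K by rewrite -natrM ler_nat.
have M2 : 625%:R * M%:R <= 147%:R * p%:R :> K by rewrite -!natrM ler_nat.
rewrite /clamp_level in b2; lra.
Qed.

End Clamp.

Local Open Scope classical_set_scope.

(** * A dense half-circle in some dilate *)

Section DenseArc.
Variables (p : nat) (A : {set 'F_p}).
Hypothesis pp : prime p.

Lemma sum_ind (F : 'F_p -> K) (u : 'F_p) : u != 0 ->
  \sum_(x < p | ind A u x) F ((x : nat)%:R * u) = \sum_(a in A) F a.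
Proof.
move=> u0; pose phi (i : 'I_p) : 'F_p := (i : nat)%:R * u.
have [psi phiK psiK] : bijective phi.
  apply: inj_card_bij; last by rewrite [X in (X <= _)%N]card_Fp // card_ord.
  move=> i j /(mulIf u0) /(congr1 val).
  by rewrite !val_Fp // !modn_small // => /val_inj.
by rewrite [RHS](reindex phi) //; exists psi => x _; rewrite ?phiK ?psiK.
Qed.

(** The coefficient of A at z is that of the dilate z A at frequency 1. *)
Lemma sum_ec_dilate z : (0 < z < p)%N ->
  \sum_(x < p | ind A 1 x) ec p (z * x) = \sum_(x < p | ind A (z%:R^-1) x) ec p x.
Proof.
move=> zp; have p0 := prime_gt0 pp.
have z0 : z%:R != 0 :> 'F_p by apply: Fp_nat_neq0.
pose F (a : 'F_p) := ec p (z * val a).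
transitivity (\sum_(a in A) F a).
  rewrite -(sum_ind F (oner_neq0 _)); apply: eq_bigr => x _.
  by rewrite /F mulr1 val_Fp // ec_mod.
rewrite -(sum_ind F (u := z%:R^-1)) ?invr_eq0 //; apply: eq_bigr => x _.
have ecm y : ec p (y %% p) = ec p y by have := ec_mod p0 1 y; rewrite !mul1n.
by rewrite /F -ecm -val_Fp // natrM Fp_natK mulrC divfK // val_Fp // ecm.
Qed.

(** If every half-circle had at most 0.2352 p points, [cos_sum_le] would contradict
    [large_coefficient]. *)
Lemma dense_arc h : p = (2 * h).+1 -> (1000 * 10 <= p)%N ->
  sum_free [set` A] -> (318 * p < 1000 * #|A|)%N ->
  exists2 u : 'F_p, u != 0 & exists a, (147 * p < 625 * cnt (ind A u) a h.+1)%N.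
Proof.
move=> ph pbig sf nbig; have p0 := prime_gt0 pp.
have nR : 318%:R / 1000%:R * p%:R < #|A|%:R :> K.
  have : 318%:R * p%:R < 1000%:R * #|A|%:R :> K by rewrite -!natrM ltr_nat.
  lra.
have [z zp hz] : exists2 z, (0 < z < p)%N & fourier_re p (ind A 1) z <= - (741%:R / 5000%:R) * p%:R.
  apply: large_coefficient => //.
  - by move=> x; apply: ind_period.
  - by move=> x y; apply: ind_sum_free.
  - by rewrite cnt_ind // oner_neq0.
have z0 : z%:R != 0 :> 'F_p by apply: Fp_nat_neq0.
pose u : 'F_p := z%:R^-1; have u0 : u != 0 by rewrite invr_eq0.
exists u => //.
have per x : ind A u (x + p) = ind A u x by apply: ind_period.
have [/existsP[a ha]|/existsPn no] :=
  boolP [exists a : 'I_p, (147 * p < 625 * cnt (ind A u) a h.+1)%N].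
  by exists a.
exfalso; pose M := (147 * p %/ 625)%N.
have arcs a : (cnt (ind A u) a h.+1 <= M)%N.
  have -> : cnt (ind A u) a h.+1 = cnt (ind A u) (a %% p) h.+1.
    apply: eq_cnt => i _; rewrite -[LHS](periodic_mod per) -[RHS](periodic_mod per).
    by rewrite modnDml.
  have := no (Ordinal (ltn_pmod a p0)); rewrite -leqNgt /= => le.
  by rewrite /M leq_divRL // mulnC.
(* This cut-off exceeds 0.079 p by at most 1, and 1 <= 0.0001 p. *)
have := @cos_sum_le p h M (ind A u) ph per arcs (79 * p %/ 1000).+1.
rewrite cnt_ind // -sum_ec_dilate // => H.
have : - (741%:R / 5000%:R) * p%:R < fourier_re p (ind A 1) z.
  have d1 := divn_eq (79 * p) 1000; have d2 : (79 * p %% 1000 < 1000)%N by rewrite ltn_pmod.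
  apply: H => //.
  - by move: d1 d2; clear; lia.
  - by move: d1 d2 pbig; clear; lia.
  - by rewrite /M mulnC leq_trunc_div.
by move=> /lt_le_trans /(_ hz); rewrite ltxx.
Qed.

End DenseArc.

Theorem theorem1 :
  exists p0 : nat, forall p : nat, prime p -> (p0 < p)%N ->
  forall A : {set 'F_p},
    sum_free [set` A] ->
    0.318%Q * p%:R < #|A|%:R :> rat ->
    exists d : int,
      [set` A] `<=`
        dilate d (residues p `[#|A|%:Z, p%:Z - #|A|%:Z]).
Proof.
(* From 10^4 on, an integer cut-off exists and the linear slacks absorb the additive constants. *)
exists (1000 * 10)%N => p pp pbig A sf nbig.
have nN : (318 * p < 1000 * #|A|)%N.
  move: nbig; have -> : 0.318%Q = fracq (318%:Z, 1000%:Z) by [].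
  rewrite fracqE -[_.1]/(318%:Z) -[_.2]/(1000%:Z) -!pmulrn => nbig.
  have : 318%:R * p%:R < 1000%:R * #|A|%:R :> rat by lra.
  by rewrite -(ltr_nat rat) !natrM.
pose h := p./2.
have ph : p = (2 * h).+1.
  have [p2|po] := even_prime pp; first by move: pbig; rewrite p2.
  by rewrite -{1}(odd_double_half p) po mul2n.
have [u u0 [a ha]] := dense_arc pp ph (ltnW pbig) sf nN.
have [||| v v0 hv] := @arc_structure p h A pp ph sf u a u0.
- by move: ha nN pbig; move: (cnt _ _ _) #|A|; clear; lia.
- by move: ha nN pbig; move: (cnt _ _ _) #|A|; clear; lia.
- by move: ha nN pbig; move: (cnt _ _ _) #|A|; clear; lia.
have np : (#|A| <= p)%N by rewrite -[X in (_ <= X)%N](card_Fp pp) max_card.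
exists (val v)%:Z => b bA.
pose x := val (b / v); have xp : (x < p)%N by apply: ltn_Fp.
have xE : x%:R = b / v :> 'F_p by apply: Fp_natK.
have [|nx xn] := hv x xp; first by rewrite /ind xE divfK.
exists (x%:R : 'F_p).
  exists x%:Z => //=.
  by rewrite in_itv /= lez_nat nx (subzn np) lez_nat.
by rewrite xE -pmulrn -mulr_natr Fp_natK divfK.
Qed.
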